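(* Let $B$ be a Banach space and $2\le q<\infty$. The following are equivalent: (i) $B$ is of martingale cotype $q$; (ii) for every probability space and filtration, every $B$-valued martingale $f=(f_n)_{n\ge1}$ bounded in $L^1_B$ satisfies $S_q(f)<\infty$ almost everywhere.
   Context: For a $B$-valued martingale $(f_n)_{n\ge1}$ (convention $f_0=0$), $S_qf=(\sum_{n\ge1}\|f_n-f_{n-1}\|_B^q)^{1/q}$. $B$ has martingale cotype $q$ if for some (equivalently every) $p\in(1,\infty)$ there is $C$ with $\|S_qf\|_{L^p}\le C\sup_n\|f_n\|_{L^p_B}$ for all $B$-valued martingales. *)

(* Defs.v *)
From HB Require Import structures.
From mathcomp Require Import all_boot all_order all_algebra.
From mathcomp Require Import all_classical all_reals all_analysis.
Set Implicit Arguments. Unset Strict Implicit. Unset Printing Implicit Defensive.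
Import Order.TTheory GRing.Theory Num.Theory.
Import numFieldNormedType.Exports.
Local Open Scope classical_set_scope.
Local Open Scope ring_scope.

Section BanachMartingales.
Context {R : realType} {B : completeNormedModType R}.
Context {d : measure_display} {T : measurableType d}.

Definition simple_in (G : set (set T)) (s : T -> B) : Prop :=
  exists (k : nat) (A : 'I_k -> set T) (b : 'I_k -> B),
    (forall i, G (A i)) /\ s = (fun x => \sum_(i < k) (\1_(A i) x) *: b i).

Definition strongly_measurable (G : set (set T)) (f : T -> B) : Prop :=
  exists s : nat -> T -> B, (forall n, simple_in G (s n)) /\
    (forall x, s n x @[n --> \oo] --> f x).

Definition simple_integral (mu : {measure set T -> \bar R}) (D : set T)
  (k : nat) (A : 'I_k -> set T) (b : 'I_k -> B) : B :=
  \sum_(i < k) fine (mu (A i `&` D)) *: b i.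

Definition is_bochner_integral (mu : {measure set T -> \bar R}) (D : set T)
  (f : T -> B) (v : B) : Prop :=
  measurable D /\ strongly_measurable measurable f /\
  exists (k : nat -> nat) (A : forall n, 'I_(k n) -> set T)
         (b : forall n, 'I_(k n) -> B),
    (forall n i, measurable (A n i) /\ (mu (A n i) < +oo)%E) /\
    (\int[mu]_(x in D) (`| f x - \sum_(i < k n) (\1_(A n i) x) *: b n i |)%:E)%E
        @[n --> \oo] --> 0%E /\
    simple_integral mu D (A n) (b n) @[n --> \oo] --> v.

(* a filtration: increasing sequence of sub-sigma-algebras;
   F n plays the role of the paper's F_(n+1) *)
Definition filtration (F : nat -> set (set T)) : Prop :=
  (forall n, sigma_algebra setT (F n)) /\
  (forall n, F n `<=` measurable) /\
  (forall n, F n `<=` F n.+1).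

(* B-valued martingale; f n plays the role of the paper's f_(n+1).
   E[f_(n+1) | F_n] = f_n is expressed by equality of Bochner integrals
   over every set of F_n. *)
Definition martingale (P : probability T R) (F : nat -> set (set T))
  (f : nat -> T -> B) : Prop :=
  (forall n, strongly_measurable (F n) (f n)) /\
  (forall n, exists v, is_bochner_integral P setT (f n) v) /\
  (forall n A, F n A ->
     exists v, is_bochner_integral P A (f n) v /\
               is_bochner_integral P A (f n.+1) v).

(* martingale differences with the convention f_0 = 0 *)
Definition mdiff (f : nat -> T -> B) (n : nat) (x : T) : B :=
  if n is m.+1 then f m.+1 x - f m x else f 0%N x.

Definition Sq (q : R) (f : nat -> T -> B) (x : T) : \bar R :=
  poweR (\sum_(0 <= n <oo) ((`| mdiff f n x |) `^ q)%:E)%E q^-1.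

Definition LpB (P : probability T R) (p : R) (g : T -> B) : \bar R :=
  Lnorm P p%:E (fun x => (`| g x |)%:E).

End BanachMartingales.

Definition martingale_cotype {R : realType} (B : completeNormedModType R)
  (q : R) : Prop :=
  exists p : R, (1 < p) /\ exists C : R,
    forall (d : measure_display) (T : measurableType d)
           (P : probability T R) (F : nat -> set (set T))
           (f : nat -> T -> B),
      filtration F -> martingale P F f ->
      (Lnorm P p%:E (Sq q f) <= C%:E * ereal_sup (range (fun n => LpB P p (f n))))%E.

(* Main.v *)
(** Both properties are equivalent to a third one, [tight]: for martingales on
    finite weighted sets started at 0, a small L1 norm forces the q-variation
    to be at least 1 only with small probability, uniformly.

    Cotype implies tightness through a Gundy decomposition: a martingale with
    small L1 norm coincides, off a set of small measure, with a martingale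
    bounded by 2 up to a perturbation of controlled variation, and the cotype
    inequality applies to the bounded one.  Almost sure finiteness implies
    tightness by contradiction: independent copies of counterexamples with
    L1 norms at most 2^-k and with P(variation >= 1) bounded below, run one
    after the other, form an L1-bounded martingale whose q-variation diverges
    almost surely by a Borel-Cantelli argument.

    Conversely, any martingale is close in L1, at finitely many times, to its
    conditional expectations on finite subalgebras of the filtration.  This
    transfers tightness to L1-bounded martingales, which gives almost sure
    finiteness; and it transfers the L2 inequality, which for finite
    martingales follows from tightness by a good-lambda inequality combined
    with Doob's inequality, so that cotype holds with p = 2. *)

Require Import Defs.
From HB Require Import structures.
From mathcomp Require Import all_boot all_order all_algebra.
From mathcomp Require Import all_classical all_reals all_analysis.
From mathcomp Require Import measurable_realfun ring lra.
Import Order.TTheory GRing.Theory Num.Theory.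
Import numFieldNormedType.Exports.
Set Implicit Arguments.
Unset Strict Implicit.
Unset Printing Implicit Defensive.
Local Open Scope classical_set_scope.
Local Open Scope ring_scope.

(** * Martingales on finite weighted sets *)

Section FiniteMartingales.
Context {R : realType} {B : normedModType R} (Omega : finType).
Implicit Types (w : Omega -> R) (X : nat -> Omega -> Omega).
Implicit Types (f : nat -> Omega -> B).

(* [X n a = X n b] means that [a] and [b] lie in the same atom of the n-th
   algebra of the filtration. *)
Record fmart w X f : Prop := FMart {
  fm_ge0 : forall a, 0 <= w a;
  fm_refine : forall n a b, X n.+1 a = X n.+1 b -> X n a = X n b;
  fm_adapted : forall n a b, X n a = X n b -> f n a = f n b;
  fm_mean : forall n c,
    \sum_(a | X n a == c) w a *: (f n.+1 a - f n a) = 0 }.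

Definition measurable_at X n (A : pred Omega) :=
  forall a b, X n a = X n b -> A a = A b.

Definition stopping X (tau : Omega -> nat) :=
  forall n, measurable_at X n (fun a => tau a == n).

Lemma fm_refine_le w X f : fmart w X f -> forall n m a b, (n <= m)%N ->
  X m a = X m b -> X n a = X n b.
Proof.
move=> fm n m a b; elim: m => [|m IH]; first by rewrite leqn0 => /eqP ->.
rewrite leq_eqVlt => /predU1P[->//|]; rewrite ltnS => nm /(fm_refine fm).
exact: IH.
Qed.

Lemma fm_adapted_le w X f : fmart w X f -> forall n m a b, (n <= m)%N ->
  X m a = X m b -> f n a = f n b.
Proof. by move=> fm n m a b nm /(fm_refine_le fm nm) /(fm_adapted fm). Qed.

Lemma sum_class (V : nmodType) X n (A : pred Omega) c (F : Omega -> V) :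
  measurable_at X n A ->
  \sum_(a | A a && (X n a == c)) F a =
  if [exists a, A a && (X n a == c)] then \sum_(a | X n a == c) F a else 0.
Proof.
move=> mA; case: ifPn => [/existsP[a0 /andP[Aa0 /eqP Xa0]]|].
  apply: eq_bigl => a; case: eqP => [Xa|]; last by rewrite andbF.
  by rewrite andbT -Aa0; apply: mA; rewrite Xa Xa0.
rewrite negb_exists => /forallP nA; apply: big_pred0 => a.
exact: negbTE.
Qed.

Lemma fm_norm_step w X f n (A : pred Omega) : fmart w X f ->
  measurable_at X n A ->
  \sum_(a | A a) w a * `|f n a| <= \sum_(a | A a) w a * `|f n.+1 a|.
Proof.
move=> fm mA; rewrite (partition_big (X n) xpredT) //=.
rewrite [leRHS](partition_big (X n) xpredT) //=; apply: ler_sum => c _.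
rewrite !sum_class //; case: ifP => // /existsP[a0 /andP[_ /eqP Xa0]].
have -> : \sum_(a | X n a == c) w a * `|f n a| =
          `|\sum_(a | X n a == c) w a *: f n.+1 a|.
  have -> : \sum_(a | X n a == c) w a *: f n.+1 a =
            \sum_(a | X n a == c) w a *: f n a.
    apply/eqP; rewrite -subr_eq0 -sumrB; apply/eqP.
    by rewrite -[RHS](fm_mean fm n c); apply: eq_bigr => a _; rewrite scalerBr.
  have fa0 a : X n a == c -> f n a = f n a0.
    by move=> /eqP Xa; apply: (fm_adapted fm); rewrite Xa Xa0.
  under eq_bigr => a /fa0 -> do over.
  under [X in _ = `|X|]eq_bigr => a /fa0 -> do over.
  rewrite -mulr_suml -scaler_suml normrZ ger0_norm //.
  by apply: sumr_ge0 => a _; exact: (fm_ge0 fm).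
apply: le_trans (ler_norm_sum _ _ _) _; apply: ler_sum => a _.
by rewrite normrZ ger0_norm // (fm_ge0 fm).
Qed.

Lemma measurable_at_le w X f n m A : fmart w X f -> (n <= m)%N ->
  measurable_at X n A -> measurable_at X m A.
Proof. by move=> fm nm mA a b /(fm_refine_le fm nm); exact: mA. Qed.

Lemma fm_norm_le w X f n m (A : pred Omega) : fmart w X f -> (n <= m)%N ->
  measurable_at X n A ->
  \sum_(a | A a) w a * `|f n a| <= \sum_(a | A a) w a * `|f m a|.
Proof.
move=> fm; elim: m => [|m IH]; first by rewrite leqn0 => /eqP ->.
rewrite leq_eqVlt => /predU1P[->//|]; rewrite ltnS => nm mA.
apply: le_trans (IH nm mA) _; apply: (fm_norm_step fm).
exact: (measurable_at_le fm nm mA).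
Qed.

Lemma stopping_le w X f tau n : fmart w X f -> stopping X tau ->
  measurable_at X n (fun a => (tau a <= n)%N).
Proof.
move=> fm st.
have H a b : X n a = X n b -> (tau a <= n)%N -> (tau b <= n)%N.
  move=> Xab ta; have := st _ _ _ (fm_refine_le fm ta Xab).
  by rewrite eqxx => /esym/eqP ->.
by move=> a b Xab; apply/idP/idP; apply: H.
Qed.

Lemma fm_stopped_norm_le w X f tau N : fmart w X f -> stopping X tau ->
  \sum_(a | (tau a <= N)%N) w a * `|f (tau a) a| <=
  \sum_(a | (tau a <= N)%N) w a * `|f N a|.
Proof.
move=> fm st.
have E (F : Omega -> R) : \sum_(a | (tau a <= N)%N) F a =
    \sum_(k < N.+1) \sum_(a | tau a == k) F a.
  rewrite (partition_big (fun a => inord (tau a) : 'I_N.+1) xpredT) //=.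
  apply: eq_bigr => k _; apply: eq_bigl => a; apply/andP/eqP => [[ta /eqP <-]|->].
    by rewrite inordK.
  by rewrite -ltnS ltn_ord inord_val.
rewrite !E; apply: ler_sum => k _.
under eq_bigr => a /eqP -> do over.
by apply: (fm_norm_le fm); [rewrite -ltnS|exact: st].
Qed.

Definition hit (Q : nat -> pred Omega) N a :=
  find (fun k => Q k a) (iota 0 N.+1).

Lemma hit_leP (Q : nat -> pred Omega) N a :
  reflect (exists2 k, (k <= N)%N & Q k a) (hit Q N a <= N)%N.
Proof.
rewrite /hit -ltnS -{2}(size_iota 0 N.+1) -has_find.
apply: (iffP hasP) => [[k]|[k kN Qk]].
  by rewrite mem_iota add0n ltnS => /andP[_ kN] Qk; exists k.
by exists k => //; rewrite mem_iota add0n ltnS.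
Qed.

Lemma hit_mem (Q : nat -> pred Omega) N a :
  (hit Q N a <= N)%N -> Q (hit Q N a) a.
Proof.
rewrite /hit => h; have := h; rewrite -ltnS -{2}(size_iota 0 N.+1) -has_find.
by move=> /(nth_find 0); rewrite nth_iota.
Qed.

Lemma hit_before (Q : nat -> pred Omega) N a k :
  (k < hit Q N a)%N -> (k <= N)%N -> ~~ Q k a.
Proof.
by move=> kh kN; have := before_find 0 kh; rewrite nth_iota ?add0n// => ->.
Qed.

Lemma hit_stopping w X f (Q : nat -> pred Omega) N : fmart w X f ->
  (forall n, measurable_at X n (Q n)) -> stopping X (hit Q N).
Proof.
move=> fm mQ n.
have H a b : X n a = X n b -> hit Q N a == n -> hit Q N b == n.
  move=> Xab /eqP hn.
  have QE k : (k <= n)%N -> Q k a = Q k b.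
    by move=> kn; apply: mQ; exact: (fm_refine_le fm kn).
  have [nN|Nn] := leqP n N.
    have Qn : Q n b by rewrite -QE // -[X in Q X]hn hit_mem // hn.
    have hb : (hit Q N b <= n)%N.
      rewrite leqNgt; apply/negP => nh.
      by have := hit_before nh nN; rewrite Qn.
    rewrite eqn_leq hb /= leqNgt; apply/negP => hbn.
    have hbN : (hit Q N b <= N)%N by exact: leq_trans hb nN.
    have : (hit Q N b < hit Q N a)%N by rewrite hn.
    by move=> /hit_before/(_ hbN); rewrite QE // hit_mem.
  have nE : n = N.+1.
    apply/eqP; rewrite eqn_leq Nn andbT -hn /hit.
    by rewrite -[leqRHS](size_iota 0) find_size.
  rewrite nE eqn_leq {1}/hit -[X in (_ <= X)%N](size_iota 0 N.+1) find_size /=.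
  rewrite ltnNge; apply/negP => /hit_leP [k kN].
  rewrite -QE; last by rewrite nE leqW.
  by apply/negP; apply: (@hit_before _ N) => //; rewrite hn nE ltnS.
by move=> a b Xab; apply/idP/idP; apply: H.
Qed.

Definition ftrans (c : nat -> Omega -> R) f n a : B :=
  \sum_(k < n) c k a *: (f k.+1 a - f k a).

Lemma ftransS c f n a :
  ftrans c f n.+1 a - ftrans c f n a = c n a *: (f n.+1 a - f n a).
Proof. by rewrite /ftrans big_ord_recr /= addrAC subrr add0r. Qed.

Lemma fmart_ftrans w X f c : fmart w X f ->
  (forall n a b, X n a = X n b -> c n a = c n b) -> fmart w X (ftrans c f).
Proof.
move=> fm cP; split; [exact: fm_ge0 fm|exact: fm_refine fm| |].
- move=> n a b Xab; apply: eq_bigr => k _.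
  rewrite (fm_adapted_le fm (ltnW (ltn_ord k)) Xab).
  rewrite (fm_adapted_le fm (ltn_ord k) Xab); congr (_ *: _); apply: cP.
  exact: (fm_refine_le fm (ltnW (ltn_ord k))).
- move=> n c0.
  case: (pickP (fun a => X n a == c0)) => [a0 /eqP Xa0|no]; last first.
    by rewrite big_pred0.
  transitivity (c n a0 *: \sum_(a | X n a == c0) w a *: (f n.+1 a - f n a)).
    rewrite scaler_sumr; apply: eq_bigr => a /eqP Xa.
    rewrite ftransS scalerA mulrC -scalerA; congr (_ *: _).
    by apply: cP; rewrite Xa Xa0.
  by rewrite (fm_mean fm) scaler0.
Qed.

Definition lqsum (q : R) f N a := \sum_(k < N) `|f k.+1 a - f k a| `^ q.

Definition lqnorm q f N a := lqsum q f N a `^ q^-1.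

Lemma lqsum_ge0 q f N a : 0 <= lqsum q f N a.
Proof. by apply: sumr_ge0 => k _; exact: powR_ge0. Qed.

Lemma lqsum_le q f n m a : (n <= m)%N -> lqsum q f n a <= lqsum q f m a.
Proof.
move=> nm; rewrite /lqsum -(subnK nm) addnC big_split_ord /= lerDl.
by apply: sumr_ge0 => k _; exact: powR_ge0.
Qed.

End FiniteMartingales.

(* The weight [w] is not normalized: [good_lambda] uses the property with the
   weight restricted to an event. *)
Definition tight {R : realType} (B : normedModType R) (q : R) :=
  forall e : R, 0 < e -> exists2 k : R, 0 < k &
  forall (Omega : finType) (w : Omega -> R) (X : nat -> Omega -> Omega)
         (f : nat -> Omega -> B) (N : nat),
    fmart w X f -> (forall a, f 0%N a = 0) ->
    \sum_a w a * `|f N a| <= k * \sum_a w a ->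
    \sum_(a | 1 <= lqsum q f N a) w a <= e * \sum_a w a.

(** * Tightness implies the L2 inequality *)

Section RealInequalities.
Context {R : realType}.
Implicit Types (a b s q l : R).

Lemma powRVK q s : 0 < q -> 0 <= s -> (s `^ q^-1) `^ q = s.
Proof. by move=> q0 s0; rewrite -powRrM mulVf ?powRr1 // gt_eqF. Qed.

Lemma powRKV q s : 0 < q -> 0 <= s -> (s `^ q) `^ q^-1 = s.
Proof. by move=> q0 s0; rewrite -powRrM mulfV ?powRr1 // gt_eqF. Qed.

Lemma ler_powR2r q a b : 0 < q -> 0 <= a -> 0 <= b ->
  (a `^ q <= b `^ q) = (a <= b).
Proof.
move=> q0 a0 b0; apply/idP/idP => [|ab]; last first.
  by apply: ge0_ler_powR; rewrite ?nnegrE // ltW.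
by apply: contraTT; rewrite -!ltNge => ba; apply: gt0_ltr_powR; rewrite ?nnegrE.
Qed.

Lemma ltr_powR2r q a b : 0 < q -> 0 <= a -> 0 <= b ->
  (a `^ q < b `^ q) = (a < b).
Proof. by move=> q0 a0 b0; rewrite !ltNge ler_powR2r. Qed.

Lemma ltr_powRVr q l s : 0 < q -> 0 <= l -> 0 <= s ->
  (l < s `^ q^-1) = (l `^ q < s).
Proof.
by move=> q0 l0 s0; rewrite -(ltr_powR2r q0) ?powR_ge0 // powRVK.
Qed.

Lemma powR2_ge4 q : 2 <= q -> 4 <= 2 `^ q :> R.
Proof.
move=> q2; have -> : 4 = 2 `^ 2%:R :> R by rewrite powR_mulrn //; lra.
by apply: ler_powR => //; lra.
Qed.

Lemma sum_pow2_le n : \sum_(j < n) 2 ^+ j <= 2 ^+ n :> R.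
Proof.
elim: n => [|n IH]; first by rewrite big_ord0.
by rewrite big_ord_recr /= exprS; move: IH; lra.
Qed.

Lemma sqr_le_dyadic (eta s : R) J : 0 <= eta -> 0 <= s ->
  s <= eta * 2 ^+ J ->
  s ^+ 2 <= eta ^+ 2 +
    4 * \sum_(j < J) (eta * 2 ^+ j) ^+ 2 * (eta * 2 ^+ j < s)%R%:R.
Proof.
move=> eta0 s0; elim: J => [|J IH].
  by rewrite expr0 mulr1 big_ord0 mulr0 addr0 => ?; rewrite ler_sqr.
rewrite big_ord_recr /= => sJ.
case: (ltP (eta * 2 ^+ J) s) => [_|/IH]; last first.
  by rewrite mulr0 addr0.
have h : s ^+ 2 <= (eta * 2 ^+ J.+1) ^+ 2.
  by rewrite ler_sqr // nnegrE mulr_ge0 // exprn_ge0.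
have S0 : 0 <= \sum_(j < J) (eta * 2 ^+ j) ^+ 2 * (eta * 2 ^+ j < s)%R%:R.
  by apply: sumr_ge0 => j _; rewrite mulr_ge0 // sqr_ge0.
apply: (le_trans h); rewrite mulr1 mulrDr.
have -> : (eta * 2 ^+ J.+1) ^+ 2 = 4 * (eta * 2 ^+ J) ^+ 2.
  by rewrite [2 ^+ J.+1]exprS; ring.
have e20 : 0 <= eta ^+ 2 by exact: sqr_ge0.
by move: S0 e20; set u := \sum_(_ < _) _; set v := (_ * _) ^+ 2; lra.
Qed.

Lemma sum_dyadic_le (eta s : R) J : 0 <= eta -> 0 <= s ->
  \sum_(j < J) (eta * 2 ^+ j) * (eta * 2 ^+ j < s)%R%:R <= 2 * s.
Proof.
move=> eta0 s0; elim: J => [|J IH]; first by rewrite big_ord0 mulr_ge0.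
rewrite big_ord_recr /=; case: ltP => [sJ|_]; last by rewrite mulr0 addr0.
rewrite mulr1.
have : \sum_(j < J) (eta * 2 ^+ j) * (eta * 2 ^+ j < s)%R%:R <= eta * 2 ^+ J.
  apply: (@le_trans _ _ (eta * \sum_(j < J) 2 ^+ j)).
    rewrite mulr_sumr; apply: ler_sum => j _.
    by rewrite ler_piMr ?mulr_ge0 ?exprn_ge0 // lern1 leq_b1.
  by rewrite ler_wpM2l // sum_pow2_le.
by move: sJ; set u := \sum_(_ < _) _; set v := eta * _; lra.
Qed.

Lemma dyadic_bound (eta s : R) : 0 < eta -> exists J, s <= eta * 2 ^+ J.
Proof.
move=> eta0; have [n sn] : exists n, s / eta <= n%:R.
  by exists (Num.Def.truncn (s / eta)).+1; rewrite ltW // truncnS_gt.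
exists n; rewrite mulrC -ler_pdivrMr //; apply: le_trans sn _.
by rewrite -natrX ler_nat ltnW // ltn_expl.
Qed.

Lemma absorb_scale (c W e : R) : 0 <= c -> 0 <= W -> 0 < e ->
  c * (e / (c * W + 1)) * W <= e.
Proof.
move=> c0 W0 e0; have cW : 0 <= c * W by exact: mulr_ge0.
have -> : c * (e / (c * W + 1)) * W = e * (c * W / (c * W + 1)).
  by field; rewrite gt_eqF //; lra.
by rewrite ger_pMr // ler_pdivrMr; lra.
Qed.

End RealInequalities.

Section LayerCake.
Context {R : realType} (Omega : finType).
Implicit Types (w S g : Omega -> R).

Lemma layer_upper w S eta J : (forall a, 0 <= w a) -> 0 <= eta ->
  (forall a, 0 <= S a <= eta * 2 ^+ J) ->
  \sum_a w a * S a ^+ 2 <= eta ^+ 2 * \sum_a w a +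
    4 * \sum_(j < J) (eta * 2 ^+ j) ^+ 2 * \sum_(a | eta * 2 ^+ j < S a) w a.
Proof.
move=> w0 eta0 SJ.
have -> : \sum_(j < J) (eta * 2 ^+ j) ^+ 2 * \sum_(a | eta * 2 ^+ j < S a) w a
  = \sum_a w a * \sum_(j < J) (eta * 2 ^+ j) ^+ 2 * (eta * 2 ^+ j < S a)%R%:R.
  under [RHS]eq_bigr do rewrite mulr_sumr.
  rewrite exchange_big; apply: eq_bigr => j _ /=.
  rewrite mulr_sumr big_mkcond; apply: eq_bigr => a _ /=.
  by case: ifP => _; rewrite ?mulr1 ?mulr0 // mulrC.
rewrite !mulr_sumr -big_split /=; apply: ler_sum => a _.
have /andP[S0 Sa] := SJ a.
have := sqr_le_dyadic eta0 S0 Sa.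
move=> /(ler_wpM2l (w0 a)) /le_trans; apply.
by rewrite mulrDr mulrC [4 * (_ * _)]mulrCA.
Qed.

Lemma layer_lower w g S eta J : (forall a, 0 <= w a) -> 0 <= eta ->
  (forall a, 0 <= S a) -> (forall a, 0 <= g a) ->
  \sum_(j < J) (eta * 2 ^+ j) * \sum_(a | eta * 2 ^+ j < S a) w a * g a <=
  2 * \sum_a w a * (S a * g a).
Proof.
move=> w0 eta0 S0 g0.
have -> : \sum_(j < J) (eta * 2 ^+ j) * \sum_(a | eta * 2 ^+ j < S a) w a * g a
  = \sum_a w a * g a *
      \sum_(j < J) (eta * 2 ^+ j) * (eta * 2 ^+ j < S a)%R%:R.
  under [RHS]eq_bigr do rewrite mulr_sumr.
  rewrite exchange_big; apply: eq_bigr => j _ /=.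
  rewrite mulr_sumr big_mkcond; apply: eq_bigr => a _ /=.
  by case: ifP => _; rewrite ?mulr1 ?mulr0 // mulrC.
rewrite mulr_sumr; apply: ler_sum => a _.
have -> : 2 * (w a * (S a * g a)) = w a * g a * (2 * S a) by ring.
by apply: ler_wpM2l; [exact: mulr_ge0|exact: sum_dyadic_le].
Qed.

End LayerCake.

Section GoodLambda.
Context {R : realType} {B : normedModType R} (Omega : finType).
Implicit Types (w : Omega -> R) (X : nat -> Omega -> Omega).
Implicit Types (f : nat -> Omega -> B).

Definition maxnorm f N a : R := \big[Num.max/0]_(k < N.+1) `|f k a|.

Lemma maxnorm_ge0 f N a : 0 <= maxnorm f N a.
Proof. by rewrite /maxnorm; elim/big_ind: _ => // x y x0 y0; rewrite le_max x0. Qed.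

Lemma le_maxnorm f N a k : (k <= N)%N -> `|f k a| <= maxnorm f N a.
Proof.
move=> kN; have kN' : (k < N.+1)%N by [].
exact: (le_bigmax 0 (fun i : 'I_N.+1 => `|f i a|) (Ordinal kN')).
Qed.

Lemma lt_maxnormP f N a (l : R) : 0 <= l ->
  (l < maxnorm f N a) = (hit (fun k b => l < `|f k b|)%R N a <= N)%N.
Proof.
move=> l0; apply/idP/hit_leP => [|[k kN /lt_le_trans]]; last first.
  by apply; exact: le_maxnorm.
rewrite ltNge => /negP h; apply: contrapT => nk; apply: h.
apply/bigmax_leP; split => // i _; rewrite leNgt; apply/negP => li.
by apply: nk; exists i => //; rewrite -ltnS.
Qed.

Lemma doob_weak w X f N (l : R) : fmart w X f -> 0 <= l ->
  l * \sum_(a | l < maxnorm f N a) w a <=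
  \sum_(a | l < maxnorm f N a) w a * `|f N a|.
Proof.
move=> fm l0; under eq_bigl do rewrite lt_maxnormP //.
under [leRHS]eq_bigl do rewrite lt_maxnormP //.
have st : stopping X (hit (fun k b => l < `|f k b|) N).
  by apply: (hit_stopping N fm) => n a b /(fm_adapted fm) ->.
apply: le_trans (fm_stopped_norm_le N fm st).
rewrite mulr_sumr; apply: ler_sum => a /hit_mem ha.
by rewrite mulrC ler_wpM2l ?(fm_ge0 fm) // ltW.
Qed.

Lemma doob_L2 w X f N : fmart w X f ->
  \sum_a w a * maxnorm f N a ^+ 2 <= 64 * \sum_a w a * `|f N a| ^+ 2.
Proof.
move=> fm; have w0 := fm_ge0 fm.
set F := \sum_a w a * `|f N a| ^+ 2; set M2 := \sum_a _.
set W := \sum_a w a.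
have W0 : 0 <= W by exact: sumr_ge0.
suff H eta : 0 < eta -> M2 <= 64 * F + 2 * eta ^+ 2 * W.
  apply/ler_addgt0Pl => e e0.
  have d0 : 0 < 2 * W + 1 by lra.
  have := H (Num.sqrt (e / (2 * W + 1))).
  rewrite sqrtr_gt0 divr_gt0 // => /(_ isT); rewrite sqr_sqrtr; last first.
    by rewrite divr_ge0 // ltW.
  move=> /le_trans; apply; rewrite addrC lerD2r.
  by apply: absorb_scale => //; lra.
move=> eta0.
have [J MJ] : exists J, forall a, maxnorm f N a <= eta * 2 ^+ J.
  have [J SJ] := dyadic_bound (\sum_a maxnorm f N a) eta0.
  exists J => a; apply: le_trans SJ; rewrite (bigD1 a) //= lerDl.
  by apply: sumr_ge0 => b _; exact: maxnorm_ge0.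
have := @layer_upper _ _ w (maxnorm f N) eta J w0 (ltW eta0).
move=> /(_ (fun a => introT andP (conj (maxnorm_ge0 f N a) (MJ a)))).
have L := layer_lower J w0 (ltW eta0) (maxnorm_ge0 f N) (fun a => normr_ge0 (f N a)).
have D : \sum_(j < J) (eta * 2 ^+ j) ^+ 2 * \sum_(a | eta * 2 ^+ j < maxnorm f N a) w a
  <= 2 * \sum_a w a * (maxnorm f N a * `|f N a|).
  apply: le_trans L; apply: ler_sum => j _.
  have l0 : 0 <= eta * 2 ^+ j by apply: mulr_ge0; [exact: ltW|exact: exprn_ge0].
  by rewrite expr2 -mulrA ler_wpM2l // (doob_weak N fm).
have C : 16 * \sum_a w a * (maxnorm f N a * `|f N a|) <= M2 + 64 * F.
  rewrite /M2 /F !mulr_sumr -big_split /=; apply: ler_sum => a _.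
  rewrite mulrCA [64 * _]mulrCA -mulrDr ler_wpM2l //.
  have := sqr_ge0 (maxnorm f N a - 8 * `|f N a|).
  by rewrite sqrrB; set m := maxnorm _ _ _; set n := `|_|; lra.
move: D C; rewrite -/M2 -/W.
by set u := \sum_(_ < _) _; set v := \sum_(_ : _) _; lra.
Qed.

Lemma sum_threshold (V : lmodType R) (u : nat -> V) t N : (t <= N)%N ->
  \sum_(k < N) (t <= k)%N%:R *: (u k.+1 - u k) = u N - u t.
Proof.
elim: N => [|N IH]; first by rewrite leqn0 => /eqP ->; rewrite big_ord0 subrr.
rewrite leq_eqVlt => /predU1P[->|]; last first.
  by rewrite ltnS => tN; rewrite big_ord_recr /= IH // tN scale1r addrC subrKA.
rewrite subrr big1 // => k _.
by rewrite leqNgt ltn_ord scale0r.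
Qed.

Lemma lqsumS (q : R) f N a :
  lqsum q f N.+1 a = lqsum q f N a + `|f N.+1 a - f N a| `^ q.
Proof. by rewrite /lqsum big_ord_recr. Qed.

(* Tightness is applied to the increments of [f] after the first time [T] at
   which the variation exceeds [l], with the weight restricted to [T <= N].
   Since these increments vanish elsewhere, the restriction preserves the
   martingale property.  If the L1 norm of this process is too large for
   tightness to apply, then the last term alone bounds the left-hand side. *)
Lemma good_lambda (q e k : R) w X f N (l : R) : 2 <= q -> 0 < k -> 0 < l ->
  (forall (w : Omega -> R) (X : nat -> Omega -> Omega)
         (f : nat -> Omega -> B) (N : nat),
    fmart w X f -> (forall a, f 0%N a = 0) ->
    \sum_a w a * `|f N a| <= k * \sum_a w a ->
    \sum_(a | 1 <= lqsum q f N a) w a <= e * \sum_a w a) ->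
  0 <= e ->
  fmart w X f -> (forall a, f 0%N a = 0) ->
  \sum_(a | 2 * l < lqnorm q f N a) w a <=
    \sum_(a | l / 2 < maxnorm f N a) w a +
    e * \sum_(a | l < lqnorm q f N a) w a +
    2 / (k * l) * \sum_(a | l < lqnorm q f N a) w a * `|f N a|.
Proof.
move=> q2 k0 l0 Hk e0 fm f0; set S := lqnorm q f N; have w0 := fm_ge0 fm.
have q0 : 0 < q by lra.
have li0 : 0 <= l^-1 by rewrite invr_ge0 ltW.
have SE m a : 0 <= m -> (m < S a) = (m `^ q < lqsum q f N a).
  by move=> m0; rewrite /S /lqnorm ltr_powRVr // lqsum_ge0.
pose Q n a := l `^ q < lqsum q f n a.
pose T := hit Q N.
have TS a : (T a <= N)%N = (l < S a).
  rewrite SE ?ltW //; apply/hit_leP/idP => [[n nN /lt_le_trans]|lS]; last by exists N.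
  by apply; exact: lqsum_le.
have stT : stopping X T.
  apply: (hit_stopping N fm) => n a b Xab; rewrite /Q; congr (_ < _).
  apply: eq_bigr => i _.
  by rewrite (fm_adapted_le fm (ltnW (ltn_ord i)) Xab) (fm_adapted_le fm (ltn_ord i) Xab).
pose w' a := w a * (l < S a)%R%:R.
pose c n a : R := l^-1 * ((T a <= n)%N && (n < N)%N)%:R.
have cP n a b : X n a = X n b -> c n a = c n b.
  by move=> Xab; rewrite /c (stopping_le fm stT Xab).
pose h := ftrans c f.
have fmh : fmart w X h by exact: fmart_ftrans.
have fmh' : fmart w' X h.
  split; [by move=> a; rewrite mulr_ge0| exact: fm_refine fmh|exact: fm_adapted fmh|].
  move=> n d; rewrite -[RHS](fm_mean fmh n d); apply: eq_bigr => a _.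
  rewrite ftransS /c /w'; case: (boolP (_ && _)) => [/andP[Tn nN]|_]; last first.
    by rewrite mulr0 scale0r !scaler0.
  by rewrite -TS (leq_trans Tn (ltnW nN)) !mulr1.
have hE a : (T a <= N)%N -> h N a = l^-1 *: (f N a - f (T a) a).
  move=> TN; rewrite -(sum_threshold (fun n => f n a) TN) scaler_sumr.
  by apply: eq_bigr => i _; rewrite /c ltn_ord andbT scalerA.
have lqh a : (T a <= N)%N ->
    lqsum q h N a = l^-1 `^ q * (lqsum q f N a - lqsum q f (T a) a).
  move=> TN; have := @sum_threshold R^o (fun n => lqsum q f n a) _ _ TN.
  move=> /= <-; rewrite mulr_sumr; apply: eq_bigr => i _.
  rewrite ftransS normrZ powRM // /c ltn_ord andbT normrM powRM // normfV.
  rewrite (gtr0_norm l0) -mulrA; congr (_ * _).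
  rewrite lqsumS addrAC subrr add0r /GRing.scale /=.
  by case: (T a <= i)%N; rewrite ?normr1 ?powR1 // normr0 powR0 // gt_eqF.
have W'E (F : Omega -> R) : \sum_a w' a * F a = \sum_(a | l < S a) w a * F a.
  rewrite [RHS]big_mkcond; apply: eq_bigr => a _; rewrite /w'.
  by case: ifP; rewrite ?mulr1 // mulr0 mul0r.
have W'E1 : \sum_a w' a = \sum_(a | l < S a) w a.
  have := W'E (fun=> 1); under eq_bigr do rewrite mulr1.
  by move=> ->; apply: eq_bigr => a; rewrite mulr1.
have good a : 2 * l < S a -> ~~ (l / 2 < maxnorm f N a) ->
    (l < S a) && (1 <= lqsum q h N a).
  move=> Sa; rewrite -leNgt => Ma.
  have lS : l < S a by apply: lt_trans Sa; lra.
  rewrite lS /=; have TN : (T a <= N)%N by rewrite TS.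
  have fl n : (n <= N)%N -> `|f n a| <= l / 2.
    by move=> nN; apply: le_trans Ma; exact: le_maxnorm.
  have sT : lqsum q f (T a) a <= 2 * l `^ q.
    case Tm: (T a) => [|m].
      by rewrite /lqsum big_ord0 mulr_ge0 // powR_ge0.
    have mN : (m < N)%N by rewrite -Tm.
    rewrite lqsumS; have : ~~ Q m a.
      by apply: (@hit_before _ _ N); rewrite -/(T a) ?Tm // ltnW.
    rewrite /Q -leNgt; have : `|f m.+1 a - f m a| `^ q <= l `^ q.
      rewrite ler_powR2r ?normr_ge0 ?(ltW l0) //; apply: le_trans (ler_normB _ _) _.
      by have := fl _ mN; have := fl _ (ltnW mN); lra.
    by lra.
  rewrite lqh // -(ler_pM2l (powR_gt0 q l0)) mulr1 mulrA.
  have -> : l `^ q * l^-1 `^ q = 1.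
    by rewrite -powRM ?invr_ge0 ?ltW // mulfV ?gt_eqF // powR1.
  rewrite mul1r; move: Sa; rewrite SE; last by rewrite mulr_ge0 // ltW.
  rewrite (powRM _ (ler0n R 2) (ltW l0)); have := powR2_ge4 q2.
  move=> /(ler_wpM2r (powR_ge0 l q)); have := powR_ge0 l q.
  by move: sT; set u := lqsum _ _ _ _; set v := lqsum _ _ _ _; lra.
have B1 : \sum_(a | 2 * l < S a) w a <= \sum_(a | l / 2 < maxnorm f N a) w a +
    \sum_(a | 1 <= lqsum q h N a) w' a.
  rewrite !(big_mkcond (fun a => _ < _)) (big_mkcond (fun a => 1 <= _)) -big_split /=.
  apply: ler_sum => a _; rewrite /w'; case: ifPn => [Sa|_]; last first.
    by rewrite addr_ge0 //; case: ifP => // _; rewrite mulr_ge0.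
  case: ifPn => [_|nM]; first by rewrite lerDl; case: ifP => // _; rewrite mulr_ge0.
  by have /andP[-> ->] := good _ Sa nM; rewrite mulr1 add0r.
have [/(Hk _ _ _ _ fmh')|] := leP (\sum_a w' a * `|h N a|) (k * \sum_a w' a).
  have h0 a : h 0%N a = 0 by rewrite /h /ftrans big_ord0.
  move=> /(_ h0); rewrite W'E1 => Hh; apply: (le_trans B1).
  rewrite -addrA lerD2l; apply: (le_trans Hh); rewrite lerDl.
  apply: mulr_ge0; last by apply: sumr_ge0 => a _; exact: mulr_ge0.
  by apply: divr_ge0 => //; apply: mulr_ge0; exact: ltW.
rewrite W'E1 W'E => Hh.
have Hh2 : \sum_(a | l < S a) w a * `|h N a| <=
    l^-1 * (2 * \sum_(a | l < S a) w a * `|f N a|).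
  apply: (@le_trans _ _ (l^-1 * (\sum_(a | l < S a) w a * `|f N a| +
      \sum_(a | l < S a) w a * `|f (T a) a|))).
    rewrite -big_split /= mulr_sumr; apply: ler_sum => a; rewrite -TS => TN.
    rewrite hE // normrZ normfV (gtr0_norm l0) mulrCA -mulrDr (ler_wpM2l li0) //.
    by rewrite ler_wpM2l // ler_normB.
  rewrite (ler_wpM2l li0) // mulr2n mulrDl mul1r lerD2l.
  have := fm_stopped_norm_le N fm stT.
  by under eq_bigl do rewrite TS; under [leRHS]eq_bigl do rewrite TS.
apply: (@le_trans _ _ (\sum_(a | l < S a) w a)).
  rewrite !(big_mkcond (fun a => _ < _)) /=; apply: ler_sum => a _.
  case: ifPn => [Sa|_]; last by case: ifP.
  by rewrite ifT //; apply: lt_trans Sa; lra.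
apply: (@le_trans _ _ (2 / (k * l) * \sum_(a | l < S a) w a * `|f N a|)); last first.
  rewrite lerDr addr_ge0 ?mulr_ge0 //; exact: sumr_ge0.
rewrite -(ler_pM2l k0); apply: (le_trans (ltW Hh)); apply: (le_trans Hh2).
rewrite le_eqVlt; apply/orP; left; apply/eqP.
by field; rewrite !gt_eqF.
Qed.

End GoodLambda.

Lemma tight_L2 {R : realType} (B : normedModType R) (q : R) :
  2 <= q -> tight B q -> exists2 C : R, 0 < C &
  forall (Omega : finType) (w : Omega -> R) (X : nat -> Omega -> Omega)
         (f : nat -> Omega -> B) (N : nat),
    fmart w X f -> (forall a, f 0%N a = 0) ->
    \sum_a w a * lqnorm q f N a ^+ 2 <=
      C * \sum_a w a * `|f N a| ^+ 2.
Proof.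
move=> q2 Ht; have e0 : 0 < 1/64 :> R by lra.
have [k k0 Hk] := Ht _ e0.
exists (16 * (1040 + (32 / k) ^+ 2)).
  by have := sqr_ge0 (32 / k); lra.
move=> Omega w X f N fm f0; have w0 := fm_ge0 fm.
set S := lqnorm q f N.
have S0 a : 0 <= S a by exact: powR_ge0.
set F := \sum_a w a * `|f N a| ^+ 2; set S2 := \sum_a _.
set W := \sum_a w a.
have W0 : 0 <= W by exact: sumr_ge0.
suff H eta : 0 < eta -> S2 <= 16 * (1040 + (32 / k) ^+ 2) * F + 16 * eta ^+ 2 * W.
  apply/ler_addgt0Pl => e e'0.
  have d0 : 0 < 16 * W + 1 by lra.
  have := H (Num.sqrt (e / (16 * W + 1))).
  rewrite sqrtr_gt0 divr_gt0 // => /(_ isT); rewrite sqr_sqrtr; last first.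
    by rewrite divr_ge0 // ltW.
  move=> /le_trans; apply; rewrite addrC lerD2r.
  by apply: absorb_scale => //; lra.
move=> eta0.
have [J SJ] : exists J, forall a, S a / 2 <= eta * 2 ^+ J.
  have [J SJ] := dyadic_bound (\sum_a S a / 2) eta0.
  exists J => a; apply: le_trans SJ; rewrite (bigD1 a) //= lerDl.
  by apply: sumr_ge0 => b _; rewrite divr_ge0.
have lt2 l a : (l < S a / 2) = (2 * l < S a) by rewrite ltr_pdivlMr // mulrC.
have U := @layer_upper _ _ w (fun a => S a / 2) eta J w0 (ltW eta0).
have {}U := U (fun a => introT andP (conj (divr_ge0 (S0 a) (ler0n _ 2)) (SJ a))).
pose M := maxnorm f N.
have M20 a : 0 <= 2 * M a by rewrite mulr_ge0 // maxnorm_ge0.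
have L1 := layer_lower J w0 (ltW eta0) M20 (fun a => normr_ge0 (f N a)).
have L2 := layer_lower J w0 (ltW eta0) S0 (fun a => normr_ge0 (f N a)).
have L3 := layer_lower J w0 (ltW eta0) S0 S0.
set L1l := \sum_(j < J) _ in L1; set L2l := \sum_(j < J) _ in L2.
set L3l := \sum_(j < J) _ in L3.
have main : \sum_(j < J) (eta * 2 ^+ j) ^+ 2 * \sum_(a | eta * 2 ^+ j < S a / 2) w a
   <= 2 * L1l + (1/64 * L3l + 2 / k * L2l).
  rewrite /L1l /L2l /L3l !mulr_sumr -!big_split /=; apply: ler_sum => j _.
  set l := eta * 2 ^+ j.
  have l0 : 0 < l by rewrite mulr_gt0 // exprn_gt0.
  under eq_bigl do rewrite lt2.
  have G := @good_lambda _ _ _ _ _ _ _ _ f N l q2 k0 l0 (Hk Omega) (ltW e0) fm f0.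
  rewrite /= -/S in G.
  have D : l * \sum_(a | l < 2 * M a) w a <= 2 * \sum_(a | l < 2 * M a) w a * `|f N a|.
    have /(doob_weak N fm) : 0 <= l / 2 by rewrite divr_ge0 // ltW.
    have E a : (l / 2 < maxnorm f N a) = (l < 2 * M a).
      by rewrite ltr_pdivrMr // mulrC.
    under eq_bigl do rewrite E; under [leRHS]eq_bigl do rewrite E.
    by set u := \sum_(_ | _) _; set v := \sum_(_ | _) _; lra.
  have E a : (l / 2 < maxnorm f N a) = (l < 2 * M a).
    by rewrite ltr_pdivrMr // mulrC.
  rewrite (eq_bigl _ _ E) in G.
  have G2 : l * \sum_(a | l < S a) w a <= \sum_(a | l < S a) w a * S a.
    rewrite mulr_sumr; apply: ler_sum => a lS.
    by rewrite mulrC ler_wpM2l // ltW.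
  rewrite expr2 -mulrA.
  have -> : 2 * (l * \sum_(a | l < 2 * M a) w a * `|f N a|) +
    (1 / 64 * (l * \sum_(a | l < S a) w a * S a) +
     2 / k * (l * \sum_(a | l < S a) w a * `|f N a|)) = l *
   (2 * \sum_(a | l < 2 * M a) w a * `|f N a| +
    (1 / 64 * \sum_(a | l < S a) w a * S a +
     2 / k * \sum_(a | l < S a) w a * `|f N a|)) by ring.
  rewrite ler_pM2l //.
  apply: le_trans (ler_wpM2l (ltW l0) G) _.
  have kl : l * (2 / (k * l)) = 2 / k by field; rewrite !gt_eqF.
  rewrite !mulrDr [l * (2 / (k * l) * _)]mulrA kl.
  have : l * (1 / 64 * \sum_(a | l < S a) w a) <=
     1 / 64 * \sum_(a | l < S a) w a * S a.
    by rewrite mulrCA; apply: ler_wpM2l => //; lra.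
  move: D; set u1 := \sum_(_ | _) _; set u2 := \sum_(_ | _) _.
  by set u3 := \sum_(_ | _) _; set u4 := \sum_(_ | _) _; lra.
have D2 := doob_L2 N fm.
rewrite -/F in D2; set M2 := \sum_a _ in D2.
have U' : \sum_a w a * (S a / 2) ^+ 2 = S2 / 4.
  rewrite /S2 mulr_suml; apply: eq_bigr => a _.
  by rewrite expr_div_n mulrA; congr (_ / _); ring.
rewrite U' -/W in U.
have E1 : 32 * \sum_a w a * (M a * `|f N a|) <= 16 * M2 + 16 * F.
  rewrite /M2 /F !mulr_sumr -big_split /=; apply: ler_sum => a _.
  rewrite mulrCA ![16 * (w a * _)]mulrCA -mulrDr ler_wpM2l //.
  have := sqr_ge0 (maxnorm f N a - `|f N a|); rewrite -/(M a).
  by rewrite sqrrB; set m := M _; set n := `|_|; lra.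
have E1' : \sum_a w a * (2 * M a * `|f N a|) = 2 * \sum_a w a * (M a * `|f N a|).
  by rewrite mulr_sumr; apply: eq_bigr => a _; ring.
have E2 : 16 / k * \sum_a w a * (S a * `|f N a|) <=
    1 / 16 * S2 + (32 / k) ^+ 2 * F.
  rewrite /S2 /F !mulr_sumr -big_split /=; apply: ler_sum => a _.
  rewrite mulrCA [1 / 16 * (w a * _)]mulrCA [_ ^+ 2 * (w a * _)]mulrCA -mulrDr ler_wpM2l //.
  have := sqr_ge0 (S a / 4 - 32 / k * `|f N a|).
  set s := S a; set n := `|_|; set k' := k^-1.
  by rewrite sqrrB => h; rewrite -subr_ge0; apply: le_trans h _;
     rewrite le_eqVlt; apply/orP; left; apply/eqP; field.
have E3 : \sum_a w a * (S a * S a) = S2.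
  by apply: eq_bigr => a _; rewrite expr2.
rewrite E1' in L1; rewrite E3 in L3.
have k2 : 0 < 2 / k by rewrite divr_gt0.
have L2' := ler_wpM2l (ltW k2) L2.
move: E2 L2' main; rewrite (_ : 16 / k = 8 * (2 / k)); last by ring.
rewrite [2 / k * (2 * _)]mulrCA.
set G := (32 / k) ^+ 2; set Y := \sum_a _ * (S a * `|_|).
set k'' := 2 / k; rewrite -[8 * k'' * Y]mulrA -/G.
set Z := k'' * Y; set Q := k'' * L2l.
move: U L1 L3 E1 D2.
set u := \sum_(_ < _) _; set v := \sum_a _ * (M a * _).
rewrite -[16 * eta ^+ 2 * W]mulrA.
rewrite mulrA [16 * (_ + _)]mulrDr mulrDl -[16 * G * F]mulrA.
set GF := G * F; set eW := eta ^+ 2 * W.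
lra.
Qed.

(** * Gundy decomposition *)

Lemma ler_sum_ord {R : numDomainType} (u : nat -> R) m n :
  (forall k, 0 <= u k) -> (m <= n)%N -> \sum_(k < m) u k <= \sum_(k < n) u k.
Proof.
move=> u0 mn; rewrite -(subnKC mn) big_split_ord /= lerDl.
by apply: sumr_ge0.
Qed.

Lemma powRD_le {R : realType} (q x y : R) : 0 < q -> 0 <= x -> 0 <= y ->
  (x + y) `^ q <= 2 `^ q * (x `^ q + y `^ q).
Proof.
move=> q0; wlog yx : x y / y <= x.
  move=> H x0 y0; have [yx|/ltW xy] := leP y x; first exact: H.
  by rewrite addrC [X in _ * X]addrC; exact: H.
move=> x0 y0; apply: (@le_trans _ _ ((2 * x) `^ q)).
  by rewrite ler_powR2r ?addr_ge0 ?mulr_ge0 //; lra.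
by rewrite powRM // ler_wpM2l ?powR_ge0 // lerDl powR_ge0.
Qed.

Section ConditionalExpectation.
Context {R : realType} (Omega : finType).
Variables (w : Omega -> R) (X : nat -> Omega -> Omega).
Hypothesis w0 : forall a, 0 <= w a.

Definition condexp {V : lmodType R} n (g : Omega -> V) a : V :=
  (\sum_(b | X n b == X n a) w b)^-1 *: \sum_(b | X n b == X n a) w b *: g b.

Lemma condexp_class {V : lmodType R} n (g : Omega -> V) a b :
  X n a = X n b -> condexp n g a = condexp n g b.
Proof. by rewrite /condexp => ->. Qed.

Lemma condexp_sum_class {V : lmodType R} n (g : Omega -> V) c :
  \sum_(a | X n a == c) w a *: condexp n g a = \sum_(a | X n a == c) w a *: g a.
Proof.
have E : \sum_(a | X n a == c) w a *: condexp n g a =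
    (\sum_(a | X n a == c) w a) *: ((\sum_(a | X n a == c) w a)^-1 *:
     \sum_(a | X n a == c) w a *: g a).
  by rewrite scaler_suml; apply: eq_bigr => a /eqP Xa; rewrite /condexp Xa.
rewrite E scalerA; have [W0|/mulfV ->] := eqVneq (\sum_(a | X n a == c) w a) 0.
  rewrite W0 mul0r scale0r big1 // => a Xa.
  have /(_ a Xa) -> := psumr_eq0P (fun a _ => w0 a) W0.
  by rewrite scale0r.
by rewrite scale1r.
Qed.

Lemma condexp_sum {V : lmodType R} n (g : Omega -> V) :
  \sum_a w a *: condexp n g a = \sum_a w a *: g a.
Proof.
rewrite (partition_big (X n) xpredT) //= [RHS](partition_big (X n) xpredT) //=.
by apply: eq_bigr => c _; rewrite condexp_sum_class.
Qed.

Lemma condexp_norm_le {V : normedModType R} n (g : Omega -> V) a :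
  `|condexp n g a| <= condexp n (fun b => `|g b| : R^o) a.
Proof.
rewrite /condexp normrZ ger0_norm ?invr_ge0 ?sumr_ge0 //.
rewrite {2}/GRing.scale /= ler_wpM2l ?invr_ge0 ?sumr_ge0 //.
apply: le_trans (ler_norm_sum _ _ _) _; apply: ler_sum => b _.
by rewrite normrZ ger0_norm.
Qed.

End ConditionalExpectation.

Section Gundy.
Context {R : realType} {B : normedModType R} (Omega : finType).
Variables (w : Omega -> R) (X : nat -> Omega -> Omega) (f : nat -> Omega -> B).
Hypothesis fm : fmart w X f.
Hypothesis f0 : forall a, f 0%N a = 0.
Variable N : nat.

Let w0 : forall a, 0 <= w a := fm_ge0 fm.
Let tau := hit (fun k a => 1 < `|f k a|) N.
Let y k a := (tau a == k.+1)%:R *: (f k.+1 a - f k a).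
Let yh k := condexp w X k (y k).
Let al k : Omega -> R := condexp w X k (fun b => `|y k b| : R^o).
Let c k a := (\sum_(j < k.+1) al j a <= 1) && (k < N)%N.

(* The bounded part of the Gundy decomposition: the jump across level 1 is
   replaced by its compensator, and the process is frozen before the
   compensators accumulate to more than 1. *)
Definition gundy n a : B :=
  \sum_(k < n) (c k a)%:R *: ((k.+1 < tau a)%N%:R *: (f k.+1 a - f k a) + yh k a).

Let al_ge0 k a : 0 <= al k a.
Proof.
rewrite /al /condexp /GRing.scale /= mulr_ge0 ?invr_ge0 ?sumr_ge0 // => b _.
by rewrite mulr_ge0.
Qed.

Let tau_stopping : stopping X tau.
Proof. by apply: (hit_stopping N fm) => n a b /(fm_adapted fm) ->. Qed.

Let c_class k a b : X k a = X k b -> c k a = c k b.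
Proof.
move=> Xab; congr (_ && _); congr (_ <= _); apply: eq_bigr => j _.
by apply: condexp_class; apply: (fm_refine_le fm _ Xab); rewrite -ltnS.
Qed.

Let gundyS n a : gundy n.+1 a - gundy n a =
  (c n a)%:R *: ((n.+1 < tau a)%N%:R *: (f n.+1 a - f n a) + yh n a).
Proof. by rewrite /gundy big_ord_recr /= addrAC subrr add0r. Qed.

Lemma gundy_fmart : fmart w X gundy.
Proof.
split; [exact: w0|exact: fm_refine fm| |].
- move=> n a b Xab; apply: eq_bigr => k _.
  have kn := ltn_ord k.
  rewrite (fm_adapted_le fm (ltnW kn) Xab) (fm_adapted_le fm kn Xab).
  have Xk := fm_refine_le fm (ltnW kn) Xab.
  rewrite (c_class Xk) /yh (condexp_class _ _ Xk); congr (_ *: (_ + _)).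
  by rewrite !ltnNge (stopping_le fm tau_stopping (fm_refine_le fm kn Xab)).
- move=> n d; case: (pickP (fun a => X n a == d)) => [a0 /eqP Xa0|no]; last first.
    by rewrite big_pred0.
  transitivity ((c n a0)%:R *: (\sum_(a | X n a == d) w a *:
     ((n.+1 < tau a)%N%:R *: (f n.+1 a - f n a) + yh n a))).
    rewrite scaler_sumr; apply: eq_bigr => a /eqP Xa.
    by rewrite gundyS !scalerA mulrC; congr ((_ * _) *: _); rewrite (@c_class n a a0) // Xa.
  under eq_bigr do rewrite scalerDr.
  rewrite big_split /= /yh condexp_sum_class // -big_split /=.
  transitivity ((c n a0)%:R *: ((n < tau a0)%N%:R *:
      \sum_(a | X n a == d) w a *: (f n.+1 a - f n a))); last first.
    by rewrite (fm_mean fm) !scaler0.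
  congr (_ *: _); rewrite scaler_sumr; apply: eq_bigr => a /eqP Xa.
  have -> : (n < tau a0)%N = (n < tau a)%N.
    by rewrite !ltnNge (@stopping_le _ _ _ _ _ _ _ n fm tau_stopping a0 a) // Xa.
  rewrite -scalerDr /y -scalerDl scalerA mulrC -scalerA.
  congr (_ *: _); rewrite -natrD; congr (_%:R).
  by rewrite [in RHS]leq_eqVlt [tau a == _]eq_sym; case: ltngtP.
Qed.

Lemma gundy0 a : gundy 0 a = 0.
Proof. by rewrite /gundy big_ord0. Qed.

Lemma gundy_bounded n a : `|gundy n a| <= 2.
Proof.
pose b k := c k a && (k.+1 < tau a)%N.
have bS k : b k.+1 -> b k.
  rewrite /b /c => /andP[/andP[s kN] kt].
  rewrite (ltnW kN) (ltnW kt) !andbT; apply: le_trans s.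
  by rewrite [leRHS]big_ord_recr /= lerDl.
have P1 m : exists n, [/\ \sum_(k < m) (b k)%:R *: (f k.+1 a - f k a) = f n a,
    `|f n a| <= 1 & (b m -> n = m)].
  elim: m => [|m [j [Sj fj bj]]].
    by exists 0%N; rewrite big_ord0 f0 normr0.
  rewrite big_ord_recr /= Sj; case: (boolP (b m)) => [bm|nb]; last first.
    by exists j; split; rewrite ?scale0r ?addr0 // => /bS; rewrite (negbTE nb).
  exists m.+1; split => //; first by rewrite (bj bm) scale1r addrC subrK.
  move: bm => /andP[/andP[_ mN] mt].
  by rewrite leNgt; apply: (hit_before mt).
have P2 m : \sum_(k < m) (c k a)%:R * al k a <= 1 /\
    \sum_(k < m) (c k a)%:R * al k a <= \sum_(k < m) al k a.
  elim: m => [|m [S1 SA]]; first by rewrite !big_ord0.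
  rewrite ![\sum_(_ < m.+1) _]big_ord_recr /=; case: (boolP (c m a)) => [cm|nc].
    rewrite mul1r lerD2r; split => //.
    move: cm => /andP[cm _]; apply: le_trans cm.
    by rewrite [leRHS]big_ord_recr /= lerD2r.
  by rewrite mul0r addr0; split => //; rewrite (le_trans SA) // lerDl.
have -> : gundy n a = \sum_(k < n) (b k)%:R *: (f k.+1 a - f k a) +
    \sum_(k < n) (c k a)%:R *: yh k a.
  rewrite -big_split; apply: eq_bigr => k _ /=.
  by rewrite scalerDr scalerA -natrM mulnb.
apply: le_trans (ler_normD _ _) _; have -> : 2 = 1 + 1 :> R by lra.
apply: lerD; first by have [j [-> ? _]] := P1 n.
have [S1 _] := P2 n; apply: le_trans S1; apply: le_trans (ler_norm_sum _ _ _) _.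
apply: ler_sum => k _; rewrite normrZ normr_nat ler_wpM2l //.
exact: condexp_norm_le.
Qed.

Definition gundy_bad a := (tau a <= N)%N || (1 < \sum_(k < N) al k a).

Lemma gundy_bad_le : \sum_(a | gundy_bad a) w a <= 3 * \sum_a w a * `|f N a|.
Proof.
have tN : \sum_(a | (tau a <= N)%N) w a * `|f (tau a) a| <= \sum_a w a * `|f N a|.
  apply: le_trans (fm_stopped_norm_le N fm tau_stopping) _.
  by rewrite big_mkcond; apply: ler_sum => a _; case: ifP => // _; rewrite mulr_ge0.
have hm a : (tau a <= N)%N -> 1 < `|f (tau a) a| by exact: hit_mem.
have T1 : \sum_(a | (tau a <= N)%N) w a <= \sum_a w a * `|f N a|.
  apply: le_trans tN; apply: ler_sum => a /hm h.
  by rewrite ler_peMr // ltW.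
have T2 : \sum_(a | 1 < \sum_(k < N) al k a) w a <= 2 * \sum_a w a * `|f N a|.
  apply: (@le_trans _ _ (\sum_a w a * \sum_(k < N) al k a)).
    rewrite big_mkcond; apply: ler_sum => a _; case: ifP => [h|_].
      by rewrite ler_peMr // ltW.
    by rewrite mulr_ge0 // sumr_ge0.
  have -> : \sum_a w a * \sum_(k < N) al k a = \sum_a w a * \sum_(k < N) `|y k a|.
    under eq_bigr do rewrite mulr_sumr.
    under [RHS]eq_bigr do rewrite mulr_sumr.
    rewrite exchange_big [RHS]exchange_big; apply: eq_bigr => k _ /=.
    exact: (condexp_sum X w0 k (fun b => `|y k b| : R^o)).
  apply: (@le_trans _ _ (2 * \sum_(a | (tau a <= N)%N) w a * `|f (tau a) a|)); last first.
    by rewrite ler_wpM2l // tN.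
  rewrite mulr_sumr [leRHS]big_mkcond; apply: ler_sum => a _.
  case: ifPn => [tauN|ntauN]; last first.
    rewrite big1 ?mulr0 // => k _; rewrite /y; case: eqP => [tk|_]; last first.
      by rewrite scale0r normr0.
    by move: ntauN; rewrite tk ltn_ord.
  rewrite mulrCA ler_wpM2l //; have := hm a tauN.
  case Ht: (tau a) => [|t]; first by rewrite f0 normr0 ltNge ler01.
  have tN' : (t < N)%N by rewrite -Ht.
  move=> ft; rewrite (bigD1 (Ordinal tN')) //= big1 => [|k kt].
    rewrite addr0 /y Ht eqxx scale1r; apply: le_trans (ler_normB _ _) _.
    have : ~~ (1 < `|f t a|).
      have tt : (t < tau a)%N by rewrite Ht.
      exact: hit_before tt (ltnW tN').
    by rewrite -leNgt; lra.
  rewrite /y Ht eqSS; case: eqP => [tk|_]; last by rewrite scale0r normr0.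
  by move: kt; rewrite -val_eqE /= -tk eqxx.
have -> : 3 * \sum_a w a * `|f N a| = \sum_a w a * `|f N a| + 2 * \sum_a w a * `|f N a|.
  by lra.
apply: le_trans (lerD T1 T2).
rewrite [leLHS]big_mkcond [X in _ <= X + _]big_mkcond [X in _ <= _ + X]big_mkcond /=.
rewrite -big_split /=; apply: ler_sum => a _; rewrite /gundy_bad.
by case: (_ <= _)%N; case: (1 < _) => /=; rewrite ?addr0 ?add0r ?lerDl.
Qed.

Lemma gundy_good (q : R) a : 1 <= q -> ~~ gundy_bad a ->
  lqsum q f N a <= 2 `^ q * (lqsum q gundy N a + 1).
Proof.
move=> q1; have q0 : 0 < q by lra.
rewrite negb_or -ltnNge -leNgt => /andP[Nt A1].
apply: (@le_trans _ _ (2 `^ q * (lqsum q gundy N a + \sum_(k < N) al k a))); last first.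
  by rewrite ler_wpM2l ?powR_ge0 // lerD2l.
rewrite -big_split mulr_sumr; apply: ler_sum => k _ /=.
have ck : c k a.
  rewrite /c ltn_ord andbT; apply: le_trans A1.
  exact: (ler_sum_ord (al_ge0^~ a)).
have dE : f k.+1 a - f k a = (gundy k.+1 a - gundy k a) - yh k a.
  by rewrite gundyS ck scale1r (leq_ltn_trans (ltn_ord k) Nt) scale1r addrK.
rewrite dE; set u := gundy _ _ - _.
have v1 : `|yh k a| <= al k a by exact: condexp_norm_le.
have al1 : al k a <= 1.
  by apply: le_trans A1; rewrite (bigD1 k) //= lerDl sumr_ge0.
apply: (@le_trans _ _ ((`|u| + `|yh k a|) `^ q)).
  by rewrite ler_powR2r ?addr_ge0 // ler_normB.
apply: le_trans (powRD_le q0 (normr_ge0 _) (normr_ge0 _)) _.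
rewrite ler_wpM2l ?powR_ge0 // lerD2l; apply: le_trans v1.
have [->|vn0] := eqVneq (yh k a) 0; first by rewrite normr0 powR0 // gt_eqF.
by apply: ge1r_powR => //; rewrite normr_gt0 vn0 (le_trans _ al1) // condexp_norm_le.
Qed.

End Gundy.

(** * Finite-valued random variables and Bochner integrals *)

Definition pr {d} {T : measurableType d} {R : realType}
  (P : {measure set T -> \bar R}) (A : set T) : R := fine (P A).

Section FiniteValued.
Context {d : measure_display} {T : measurableType d} {R : realType}.
Variable P : probability T R.

Lemma prE A : measurable A ->
  (P : {measure set T -> \bar R}) A = (pr P A)%:E.
Proof. by move=> mA; rewrite /pr fineK // fin_num_measure. Qed.

Lemma pr_ge0 A : 0 <= pr P A.
Proof. by rewrite /pr fine_ge0. Qed.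

Lemma pr_le A C : measurable A -> measurable C -> A `<=` C -> pr P A <= pr P C.
Proof.
move=> mA mC AC; rewrite -lee_fin -!prE //.
by apply: le_measure; rewrite ?inE.
Qed.

Lemma prT : pr P setT = 1.
Proof. exact: (congr1 fine (probability_setT P)). Qed.

Variables (Omega : finType) (H : T -> Omega).
Hypothesis mH : forall i, measurable (H @^-1` [set i]).

Lemma measurable_preim_fin (Y : set Omega) : measurable (H @^-1` Y).
Proof.
have -> : H @^-1` Y = \bigcup_(i in Y) H @^-1` [set i].
  by apply/seteqP; split => x /=; [move=> Yx; exists (H x)|case=> i Yi ->].
by apply: fin_bigcup_measurable => // i _.
Qed.

Lemma measurable_fun_fin d' (V : measurableType d') (D : set T) (g : Omega -> V) :
  measurable_fun D (g \o H).
Proof.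
by move=> mD Y mY; apply: measurableI => //; exact: (measurable_preim_fin (g @^-1` Y)).
Qed.

Lemma integral_fin (A : set T) (g : Omega -> R) : measurable A -> (forall i, 0 <= g i) ->
  (\int[P]_(x in A) (g (H x))%:E =
   (\sum_i g i * pr P (H @^-1` [set i] `&` A))%:E)%E.
Proof.
move=> mA g0.
transitivity (\int[P]_(x in A)
   \sum_(i <- enum Omega) ((g i)%:E * (\1_(H @^-1` [set i]) x)%:E))%E.
  apply: eq_integral => x _; rewrite big_enum /= (bigD1 (H x)) //=.
  rewrite big1 ?adde0 => [|i iH]; first by rewrite indicE mem_set // mule1.
  rewrite indicE memNset ?mule0 //= => Hi.
  by move: iH; rewrite Hi eqxx.
rewrite ge0_integral_sum //; last 2 first.
- move=> i; apply: measurable_funeM; apply/measurable_EFinP.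
  exact: measurable_indic.
- by move=> i x _; rewrite mule_ge0 ?lee_fin.
rewrite big_enum /= -sumEFin; apply: eq_bigr => i _.
rewrite ge0_integralZl //; last 2 first.
- by apply/measurable_EFinP; exact: measurable_indic.
- by rewrite lee_fin.
rewrite integral_indic // prE ?EFinM //; exact: measurableI.
Qed.

Lemma pr_fin (Phi : pred Omega) :
  pr P [set x | Phi (H x)] = \sum_(i | Phi i) pr P (H @^-1` [set i]).
Proof.
have mA : measurable [set x | Phi (H x)] by exact: (measurable_preim_fin [set i | Phi i]).
have := integral_fin mA (fun=> ler01).
rewrite integral_cst // mul1e prE // => -[->].
rewrite [RHS]big_mkcond; apply: eq_bigr => i _; rewrite mul1r; case: ifPn => Pi.
  congr (pr P _); apply/seteqP; split=> x /= => [[]//|Hx]; split => //.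
  by rewrite Hx.
rewrite (_ : _ `&` _ = set0) ?/pr ?measure0 //; apply/seteqP; split=> x //= -[->].
by rewrite (negbTE Pi).
Qed.

Lemma pr_finI (A : set T) : measurable A ->
  pr P A = \sum_i pr P (H @^-1` [set i] `&` A).
Proof.
move=> mA; have := integral_fin mA (fun=> ler01).
rewrite integral_cst // mul1e prE // => -[->].
by apply: eq_bigr => i _; rewrite mul1r.
Qed.

Lemma expectation_fin (g : Omega -> R) : (forall i, 0 <= g i) ->
  (\int[P]_x (g (H x))%:E = (\sum_i pr P (H @^-1` [set i]) * g i)%:E)%E.
Proof.
move=> g0; rewrite integral_fin //; congr (_%:E); apply: eq_bigr => i _.
by rewrite setIT mulrC.
Qed.

End FiniteValued.

Lemma measurable_bits {d} {T : measurableType d} (J : finType) (A : J -> set T) :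
  (forall j, measurable (A j)) -> forall omega : {ffun J -> bool},
  measurable ((fun x => [ffun j => x \in A j]) @^-1` [set omega]).
Proof.
move=> mA omega.
have -> : (fun x => [ffun j => x \in A j]) @^-1` [set omega] =
    \bigcap_(j in [set: J]) (if omega j then A j else ~` A j).
  apply/seteqP; split=> x /=.
    move=> <- j _; rewrite ffunE; case: ifPn => [|]; first by rewrite inE.
    by move=> /negP xA /= Ax; apply: xA; rewrite inE.
  move=> Ax; apply/ffunP => j; rewrite ffunE; have := Ax j I.
  by case: (omega j) => Aj; [rewrite mem_set|rewrite memNset].
apply: fin_bigcap_measurable => // j _.
by case: ifP => _ //; exact: measurableC.
Qed.

Definition simple_fun {R : realType} {B : completeNormedModType R} {T : Type}
  k (A : 'I_k -> set T) (b : 'I_k -> B) (x : T) : B :=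
  \sum_(i < k) (\1_(A i) x) *: b i.

Section StronglyMeasurable.
Context {R : realType} {B : completeNormedModType R}.

Definition fin_valued {d} {T : measurableType d} (s : T -> B) :=
  exists (Omega : finType) (H : T -> Omega) (g : Omega -> B),
    (forall i, measurable (H @^-1` [set i])) /\ s = g \o H.

Lemma simple_in_fin_valued {d} {T : measurableType d} (s : T -> B) :
  simple_in measurable s -> fin_valued s.
Proof.
move=> [k [A [b [mA ->]]]].
exists {ffun 'I_k -> bool}, (fun x => [ffun j => x \in A j]).
exists (fun omega : {ffun 'I_k -> bool} => \sum_(i < k) (omega i)%:R *: b i); split.
  exact: measurable_bits.
by apply/funext => x /=; apply: eq_bigr => i _; rewrite ffunE.
Qed.

Lemma measurable_pair {d} {T : measurableType d} (Omega Omega' : finType)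
  (H : T -> Omega) (H' : T -> Omega') :
  (forall i, measurable (H @^-1` [set i])) ->
  (forall i, measurable (H' @^-1` [set i])) ->
  forall i, measurable ((fun x => (H x, H' x)) @^-1` [set i]).
Proof.
move=> mH mH' [i j].
have -> : (fun x => (H x, H' x)) @^-1` [set (i, j)] =
    H @^-1` [set i] `&` H' @^-1` [set j].
  by apply/seteqP; split => x /= [-> ->].
exact: measurableI.
Qed.

Lemma measurable_norm_sub {d} {T : measurableType d} (D : set T) (u v : T -> B) :
  strongly_measurable measurable u -> strongly_measurable measurable v ->
  measurable_fun D (fun x => `|u x - v x|).
Proof.
move=> [s [sF su]] [t [tF tv]].
apply: (@measurable_fun_cvg _ _ _ _ (fun n x => `|s n x - t n x|)).
  move=> n; have [Om [H [g [mH ->]]]] := simple_in_fin_valued (sF n).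
  have [Om' [H' [g' [mH' ->]]]] := simple_in_fin_valued (tF n).
  exact: (@measurable_fun_fin _ _ _ _ (measurable_pair mH mH') _ _ D
    (fun p => `|g p.1 - g' p.2|)).
by move=> x _; apply: cvg_norm; apply: cvgB; [exact: su|exact: tv].
Qed.

Lemma simple_fun_fin {T : Type} (Omega : finType) (H : T -> Omega) (g : Omega -> B) :
  simple_fun (fun i : 'I_#|Omega| => H @^-1` [set enum_val i])
    (fun i => g (enum_val i)) = g \o H.
Proof.
apply/funext => x /=; rewrite /simple_fun (bigD1 (enum_rank (H x))) //= enum_rankK.
rewrite indicE mem_set // scale1r big1 ?addr0 // => i iH.
rewrite indicE memNset ?scale0r //= => Hx.
by move: iH; rewrite Hx enum_valK eqxx.
Qed.

Lemma simple_fin {d} {T : measurableType d} (G : set (set T)) (Omega : finType)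
  (H : T -> Omega) (g : Omega -> B) :
  (forall i, G (H @^-1` [set i])) -> simple_in G (g \o H).
Proof.
move=> GH; exists #|Omega|, (fun i => H @^-1` [set enum_val i]).
exists (fun i => g (enum_val i)); split; first by move=> i; exact: GH.
by rewrite -simple_fun_fin.
Qed.

Lemma simple_strongly_measurable {d} {T : measurableType d} (G : set (set T)) (s : T -> B) :
  simple_in G s -> strongly_measurable G s.
Proof. by move=> sG; exists (fun=> s); split=> // x; exact: cvg_cst. Qed.

Lemma strongly_measurable_fin {d} {T : measurableType d} (Omega : finType)
  (H : T -> Omega) (g : Omega -> B) :
  (forall i, measurable (H @^-1` [set i])) ->
  strongly_measurable measurable (g \o H).
Proof. by move=> mH; apply: simple_strongly_measurable; exact: simple_fin. Qed.

Lemma strongly_measurable_sub {d} {T : measurableType d} (G G' : set (set T)) (u : T -> B) :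
  G `<=` G' -> strongly_measurable G u -> strongly_measurable G' u.
Proof.
move=> GG' [s [sG su]]; exists s; split=> // n.
by have [k [A [b [GA ->]]]] := sG n; exists k, A, b; split => // i; exact/GG'.
Qed.

Lemma strongly_measurable0 {d} {T : measurableType d} :
  strongly_measurable measurable (fun _ : T => 0 : B).
Proof.
apply: simple_strongly_measurable; exists 0%N, (fun=> set0), (fun=> 0).
by split => //; apply/funext => x; rewrite big_ord0.
Qed.

Lemma measurable_norm {d} {T : measurableType d} (D : set T) (u : T -> B) :
  strongly_measurable measurable u -> measurable_fun D (fun x => `|u x|).
Proof.
move=> mu; have := @measurable_norm_sub _ _ D _ _ mu strongly_measurable0.
by apply: eq_measurable_fun => x _; rewrite subr0.
Qed.

End StronglyMeasurable.

Section Bochner.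
Context {R : realType} {B : completeNormedModType R}.
Context {d : measure_display} {T : measurableType d}.
Variable P : probability T R.
Implicit Types (u f : T -> B) (D : set T).

Lemma simple_fun_strongly_measurable k (A : 'I_k -> set T) (b : 'I_k -> B) :
  (forall i, measurable (A i)) -> strongly_measurable measurable (simple_fun A b).
Proof. by move=> mA; apply: simple_strongly_measurable; exists k, A, b. Qed.

Lemma simple_integral_fin (Omega : finType) (H : T -> Omega) D k
    (A : 'I_k -> set T) (b : 'I_k -> B) (Y : 'I_k -> pred Omega) :
  (forall i, measurable (H @^-1` [set i])) -> measurable D ->
  (forall i x, (x \in A i) = Y i (H x)) ->
  simple_integral P D A b =
  \sum_omega pr P (H @^-1` [set omega] `&` D) *: \sum_(i < k) (Y i omega)%:R *: b i.
Proof.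
move=> mH mD AY.
have AE i : A i = H @^-1` [set omega | Y i omega].
  by apply/seteqP; split=> x /=; rewrite -AY inE.
under [RHS]eq_bigr do rewrite scaler_sumr.
rewrite exchange_big; apply: eq_bigr => i _ /=.
under eq_bigr do rewrite scalerA.
rewrite -scaler_suml; congr (_ *: _); rewrite -/(pr P _).
have mA : measurable (A i) by rewrite AE; exact: measurable_preim_fin.
rewrite (pr_finI P mH (measurableI _ _ mA mD)); apply: eq_bigr => omega _.
case: (boolP (Y i omega)) => [Yi|/negP nYi].
  rewrite mulr1; congr (pr P _); apply/seteqP; split => x /=.
    by move=> [-> []].
  by move=> [Hx Dx]; rewrite AE /= Hx.
rewrite mulr0 (_ : _ `&` _ = set0) ?/pr ?measure0 //.
by apply/seteqP; split => x //=; rewrite AE /= => -[-> []].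
Qed.

Lemma simple_integral_dist D k (A : 'I_k -> set T) (b : 'I_k -> B)
    k' (A' : 'I_k' -> set T) (b' : 'I_k' -> B) :
  measurable D -> (forall i, measurable (A i)) -> (forall i, measurable (A' i)) ->
  ((`|simple_integral P D A b - simple_integral P D A' b'|)%:E <=
   \int[P]_(x in D) (`|simple_fun A b x - simple_fun A' b' x|)%:E)%E.
Proof.
move=> mD mA mA'.
pose AA (j : 'I_k + 'I_k') := match j with inl i => A i | inr i => A' i end.
have mAA j : measurable (AA j) by case: j.
pose H x : {ffun 'I_k + 'I_k' -> bool} := [ffun j => x \in AA j].
have mH := measurable_bits mAA.
rewrite (@simple_integral_fin _ H D k A b (fun i omega => omega (inl i))) //; last first.
  by move=> i x; rewrite ffunE.
rewrite (@simple_integral_fin _ H D k' A' b' (fun i omega => omega (inr i))) //; last first.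
  by move=> i x; rewrite ffunE.
rewrite -sumrB; under eq_bigr do rewrite -scalerBr.
have -> : (\int[P]_(x in D) (`|simple_fun A b x - simple_fun A' b' x|)%:E =
    \int[P]_(x in D) (`|\sum_(i < k) (H x (inl i))%:R *: b i -
       \sum_(i < k') (H x (inr i))%:R *: b' i|)%:E)%E.
  apply: eq_integral => x _; congr (`|_ - _|%:E);
  by apply: eq_bigr => i _; rewrite ffunE indicE.
rewrite (integral_fin P mH (g := fun omega : {ffun 'I_k + 'I_k' -> bool} =>
  `|\sum_(i < k) (omega (inl i))%:R *: b i - \sum_(i < k') (omega (inr i))%:R *: b' i|)) //.
rewrite lee_fin; apply: le_trans (ler_norm_sum _ _ _) _.
by apply: ler_sum => omega _; rewrite normrZ ger0_norm ?pr_ge0 // mulrC.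
Qed.

Lemma integral_norm_triangle D u v f : measurable D ->
  strongly_measurable measurable u -> strongly_measurable measurable v ->
  strongly_measurable measurable f ->
  (\int[P]_(x in D) (`|u x - v x|)%:E <=
   \int[P]_(x in D) (`|u x - f x|)%:E + \int[P]_(x in D) (`|f x - v x|)%:E)%E.
Proof.
move=> mD mu mv mf.
have muf : measurable_fun D (fun x => (`|u x - f x|)%:E).
  by apply/measurable_EFinP; exact: measurable_norm_sub.
have mfv : measurable_fun D (fun x => (`|f x - v x|)%:E).
  by apply/measurable_EFinP; exact: measurable_norm_sub.
rewrite -ge0_integralD //; apply: ge0_le_integral => //.
- by apply/measurable_EFinP; exact: measurable_norm_sub.
- exact: emeasurable_funD.
- by move=> x _; rewrite -EFinD lee_fin ler_distD.
Qed.

Lemma bochner_approx D f v e : is_bochner_integral P D f v -> 0 < e ->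
  exists k (A : 'I_k -> set T) (b : 'I_k -> B), [/\ forall i, measurable (A i),
    (\int[P]_(x in D) (`|f x - simple_fun A b x|)%:E <= e%:E)%E &
    `|v - simple_integral P D A b| <= e].
Proof.
move=> [mD [mf [k [A [b [mA [fs sv]]]]]]] e0.
have N1 : \forall n \near \oo,
    (\int[P]_(x in D) (`|f x - simple_fun (A n) (b n) x|)%:E <= e%:E)%E.
  have /fine_cvgP[fin fc] := fs.
  have N0 := cvgr_le _ fc _ e0.
  near=> n; rewrite -[leLHS]fineK; first by rewrite lee_fin; near: n; exact: N0.
  by near: n; exact: fin.
have N2 : \forall n \near \oo, `|v - simple_integral P D (A n) (b n)| <= e.
  by move/cvgrPdist_le : sv; apply.
have [n [h1 h2]] : exists n,
    (\int[P]_(x in D) (`|f x - simple_fun (A n) (b n) x|)%:E <= e%:E)%E /\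
    `|v - simple_integral P D (A n) (b n)| <= e.
  near \oo => n; exists n; split; near: n; [exact: N1|exact: N2].
by exists (k n), (A n), (b n); split => // i; have [] := mA n i.
Unshelve. all: by end_near. Qed.

Lemma bochner_dist D f v k (A : 'I_k -> set T) (b : 'I_k -> B) :
  is_bochner_integral P D f v -> (forall i, measurable (A i)) ->
  ((`|v - simple_integral P D A b|)%:E <=
   \int[P]_(x in D) (`|f x - simple_fun A b x|)%:E)%E.
Proof.
move=> Hf mA; have [mD [mf _]] := Hf.
apply/lee_addgt0Pr => e e0; have e20 : 0 < e / 2 by rewrite divr_gt0.
have [k' [A' [b' [mA' fs vs]]]] := bochner_approx Hf e20.
have ms := simple_fun_strongly_measurable b mA.
have ms' := simple_fun_strongly_measurable b' mA'.
apply: (@le_trans _ _ ((e / 2)%:E +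
   (`|simple_integral P D A' b' - simple_integral P D A b|)%:E)%E).
  by rewrite -EFinD lee_fin; apply: le_trans (ler_distD (simple_integral P D A' b') _ _) _; rewrite lerD2r.
have -> : (e%:E = (e / 2)%:E + (e / 2)%:E)%E by rewrite -EFinD -splitr.
rewrite addeA [leRHS]addeC; apply: leeD => //.
apply: le_trans (simple_integral_dist _ _ mD mA' mA) _.
apply: le_trans (integral_norm_triangle mD ms' ms mf) _.
rewrite addeC; apply: leeD => //.
by under eq_integral do rewrite distrC.
Qed.

Lemma bochner_norm D f v : is_bochner_integral P D f v ->
  ((`|v|)%:E <= \int[P]_(x in D) (`|f x|)%:E)%E.
Proof.
move=> Hf.
have := @bochner_dist D f v 0 (fun=> set0) (fun=> 0) Hf (fun=> measurable0).
rewrite /simple_integral big_ord0 subr0 => /le_trans; apply.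
by under eq_integral do rewrite /simple_fun big_ord0 subr0.
Qed.

Lemma bochner_unique D f v v' : is_bochner_integral P D f v ->
  is_bochner_integral P D f v' -> v = v'.
Proof.
move=> Hv Hv'; apply/eqP; rewrite -subr_eq0 -normr_le0.
apply/ler_addgt0Pl => e e0; rewrite addr0.
have e20 : 0 < e / 2 by rewrite divr_gt0.
have [k [A [b [mA fs vs]]]] := bochner_approx Hv e20.
have := le_trans (bochner_dist b Hv' mA) fs; rewrite lee_fin => vs'.
apply: le_trans (ler_distD (simple_integral P D A b) _ _) _.
by rewrite (splitr e) lerD // distrC.
Qed.

Lemma bochner_integrable f v : is_bochner_integral P setT f v ->
  (\int[P]_x (`|f x|)%:E < +oo)%E.
Proof.
move=> Hf; have [_ [mf _]] := Hf.
have [k [A [b [mA fs _]]]] := bochner_approx Hf ltr01.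
have ms := simple_fun_strongly_measurable b mA.
have := integral_norm_triangle measurableT mf strongly_measurable0 ms.
under eq_integral do rewrite subr0.
move=> /le_lt_trans; apply; apply: lte_add_pinfty.
  exact: le_lt_trans fs (ltry _).
have [Om [H [g [mH E]]]] := simple_in_fin_valued
  (ex_intro _ k (ex_intro _ A (ex_intro _ b (conj mA erefl))) : simple_in measurable (simple_fun A b)).
under eq_integral do rewrite subr0 E /=.
by rewrite (expectation_fin P mH (g := fun i => `|g i|)) // ltry.
Qed.

Lemma bochner_additive (Omega : finType) (H : T -> Omega) (Y : pred Omega) f v0 v
    (m : Omega -> B) :
  (forall i, measurable (H @^-1` [set i])) ->
  is_bochner_integral P setT f v0 ->
  is_bochner_integral P (H @^-1` [set i | Y i]) f v ->
  (forall i, is_bochner_integral P (H @^-1` [set i]) f (m i)) ->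
  v = \sum_(i | Y i) m i.
Proof.
move=> mH Hf Hv Hm; have [_ [mf _]] := Hf.
apply/eqP; rewrite -subr_eq0 -normr_le0; apply/ler_addgt0Pl => e e0; rewrite addr0.
pose M : R := #|Omega|.+1%:R.
have M0 : 0 < M by rewrite ltr0n.
have eM0 : 0 < e / M by rewrite divr_gt0.
have [k [A [b [mA fs _]]]] := bochner_approx Hf eM0.
have ms := simple_fun_strongly_measurable b mA.
have sub D z : measurable D -> is_bochner_integral P D f z ->
    `|z - simple_integral P D A b| <= e / M.
  move=> mD Hu; rewrite -lee_fin; apply: le_trans (bochner_dist b Hu mA) _.
  apply: le_trans fs; apply: ge0_subset_integral => //.
  by apply/measurable_EFinP; exact: measurable_norm_sub.
have mY := measurable_preim_fin mH [set i | Y i].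
have IE : simple_integral P (H @^-1` [set i | Y i]) A b =
    \sum_(i | Y i) simple_integral P (H @^-1` [set i]) A b.
  rewrite exchange_big; apply: eq_bigr => j _ /=.
  rewrite -scaler_suml; congr (_ *: _); rewrite -/(pr P _).
  rewrite (pr_finI P mH (measurableI _ _ (mA j) mY)) [RHS]big_mkcond.
  apply: eq_bigr => i _; case: ifPn => [Yi|/negP nYi].
    congr (pr P _); apply/seteqP; split => x /=; first by move=> [-> []].
    by move=> [Ax Hx]; rewrite Hx.
  rewrite (_ : _ `&` _ = set0) ?/pr ?measure0 //.
  by apply/seteqP; split => x //= [-> []].
apply: le_trans (ler_distD (simple_integral P (H @^-1` [set i | Y i]) A b) _ _) _.
apply: (@le_trans _ _ (e / M + \sum_(i : Omega) e / M)).
  apply: lerD; first exact: sub.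
  rewrite distrC IE -sumrB; apply: le_trans (ler_norm_sum _ _ _) _.
  rewrite [leLHS]big_mkcond; apply: ler_sum => i _; case: ifP => _; last exact: ltW.
  by apply: sub; [exact: mH|exact: Hm].
rewrite sumr_const -[_ *+ _]mulr_natr -{1}[e / M]mulr1 -mulrDr.
by rewrite -[1]/(1%:R) -natrD add1n -/M mulfVK // gt_eqF.
Qed.

Lemma bochner_fin (Omega : finType) (H : T -> Omega) (g : Omega -> B) (Y : pred Omega) :
  (forall i, measurable (H @^-1` [set i])) ->
  is_bochner_integral P (H @^-1` [set i | Y i]) (g \o H)
    (\sum_(i | Y i) pr P (H @^-1` [set i]) *: g i).
Proof.
move=> mH; have mY := measurable_preim_fin mH [set i | Y i].
split => //; split; first exact: strongly_measurable_fin.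
pose A (i : 'I_#|Omega|) := H @^-1` [set enum_val i].
pose b (i : 'I_#|Omega|) := g (enum_val i).
exists (fun=> #|Omega|), (fun=> A), (fun=> b); split.
  by move=> _ i; split; [exact: mH|rewrite (prE P (mH _)) ltry].
split.
  apply: cvg_near_cst; apply: nearW => n; apply: integral0_eq => x _.
  by rewrite -/(simple_fun A b x) simple_fun_fin subrr normr0.
rewrite (_ : simple_integral _ _ _ _ = \sum_(i | Y i) pr P (H @^-1` [set i]) *: g i).
  exact: cvg_cst.
rewrite /simple_integral [RHS]big_mkcond (reindex _ (onW_bij _ (@enum_val_bij Omega))) /=.
apply: eq_bigr => i _; rewrite -/(pr P _) /A; set w := enum_val i.
case: ifPn => [Yi|/negP nYi].
  congr (pr P _ *: _); apply/seteqP; split => x /=; first by move=> [-> []].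
  by move=> Hx; rewrite Hx.
rewrite (_ : _ `&` _ = set0) ?/pr ?measure0 ?scale0r //.
by apply/seteqP; split => x //= [-> []].
Qed.

End Bochner.

Section SimpleApproximation.
Context {R : realType} {B : completeNormedModType R}.
Context {d : measure_display} {T : measurableType d}.

Lemma strongly_measurable_g_sigma (G : set (set T)) (f : T -> B) :
  sigma_algebra setT G -> strongly_measurable G f ->
  strongly_measurable (T := g_sigma_algebraType G) measurable f.
Proof.
move=> sG [s [sF sf]]; exists s; split => // n.
have [k [A [b [GA ->]]]] := sF n; exists k, A, b; split => // i.
by rewrite measurable_g_measurableTypeE //; exact: GA.
Qed.

Lemma L1_simple_approx (P : probability T R) (G : set (set T)) (f : T -> B) e :
  sigma_algebra setT G -> G `<=` measurable -> strongly_measurable G f ->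
  (\int[P]_x (`|f x|)%:E < +oo)%E -> 0 < e ->
  exists k (A : 'I_k -> set T) (b : 'I_k -> B), (forall i, G (A i)) /\
    (\int[P]_x (`|f x - simple_fun A b x|)%:E <= e%:E)%E.
Proof.
move=> sG Gm mf fi e0; have [s [sG' sf]] := mf.
have mfT : strongly_measurable measurable f by exact: strongly_measurable_sub mf.
(* Truncating [s n] on [D n] makes the sequence dominated by [2 * `|f x|]. *)
pose D n := [set x | `|s n x| <= 2 * `|f x|].
have GD n : G (D n).
  rewrite -(measurable_g_measurableTypeE sG).
  have m1 : measurable_fun (setT : set (g_sigma_algebraType G)) (fun x => `|s n x|).
    apply: measurable_norm; apply: strongly_measurable_g_sigma => //.
    exact: simple_strongly_measurable.
  have m2 : measurable_fun (setT : set (g_sigma_algebraType G)) (fun x => 2 * `|f x|).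
    apply: measurable_funM => //; apply: measurable_norm.
    exact: strongly_measurable_g_sigma.
  have := measurable_fun_ler m1 m2.
  move=> /(_ measurableT [set true]) /(_ _); rewrite setTI => h.
  have -> : D n = (fun x => `|s n x| <= 2 * `|f x|) @^-1` [set true].
    by apply/seteqP; split => x.
  exact: h.
pose s' n x : B := \1_(D n) x *: s n x.
have s'E n : exists k (A : 'I_k -> set T) (b : 'I_k -> B), (forall i, G (A i)) /\
    s' n = simple_fun A b.
  have [k [A [b [GA E]]]] := sG' n; exists k, (fun i => A i `&` D n), b; split.
    move=> i; have := GA i; have := GD n.
    rewrite -(measurable_g_measurableTypeE sG) => h1 h2.
    exact: (@measurableI _ (g_sigma_algebraType G)).
  apply/funext => x; rewrite /s' E /simple_fun scaler_sumr; apply: eq_bigr => i _.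
  by rewrite scalerA indicI /= mulrC.
have ms' n : strongly_measurable measurable (s' n).
  have [k [A [b [GA ->]]]] := s'E n.
  by apply: simple_fun_strongly_measurable => i; exact/Gm/GA.
have mf3 : measurable_fun setT (fun x => (3 * `|f x|)%:E).
  by apply/measurable_EFinP; apply: measurable_funM => //; exact: measurable_norm.
have ig : P.-integrable setT (fun x => (3 * `|f x|)%:E).
  apply/integrableP; split => //.
  under eq_integral do rewrite /= normrM normr_nat normr_id EFinM.
  rewrite ge0_integralZl_EFin //; first by rewrite lte_mul_pinfty.
  by apply/measurable_EFinP; exact: measurable_norm.
have mfs n : measurable_fun setT (fun x => (`|f x - s' n x|)%:E).
  by apply/measurable_EFinP; exact: measurable_norm_sub.
have dom : {ae P, forall x, forall n, setT x ->
    (`|(`|f x - s' n x|)%:E| <= (3 * `|f x|)%:E)%E}.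
  apply/nearW => x n _; rewrite /= normr_id lee_fin.
  apply: le_trans (ler_normB _ _) _.
  rewrite /s' indicE; case: (boolP (x \in D n)) => [|_].
    rewrite inE /D /= => h; rewrite scale1r; lra.
  by rewrite scale0r normr0; have := normr_ge0 (f x); lra.
have cv : {ae P, forall x, setT x -> (`|f x - s' n x|)%:E @[n --> \oo] --> 0%E}.
  apply/nearW => x _; apply: cvg_EFin; first exact: nearW.
  rewrite -(normr0 B) -[X in `|X|](subrr (f x)); apply: cvg_norm; apply: cvgB.
    exact: cvg_cst.
  have [fx0|fx0] := eqVneq (f x) 0.
    rewrite fx0; apply: cvg_near_cst; apply: nearW => n.
    rewrite /s' indicE; case: (boolP (x \in D n)) => [|_]; last by rewrite scale0r.
    by rewrite inE /D /= fx0 normr0 mulr0 normr_le0 => /eqP ->; rewrite scaler0.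
  apply: cvg_trans (sf x); apply: near_eq_cvg.
  have h : `|f x| < 2 * `|f x| by rewrite ltr_pMl ?normr_gt0 // ltr1n.
  have H := cvgr_le _ (cvg_norm (sf x)) _ h.
  near=> n; rewrite /s' indicE mem_set ?scale1r //=; near: n; exact: H.
have m0 : measurable_fun setT (fun _ : T => 0%E : \bar R) by exact: measurable_cst.
have [_ _] := dominated_convergence measurableT mfs m0 cv ig dom.
rewrite integral0 => c0.
have [n hn] : exists n, (\int[P]_x (`|f x - s' n x|)%:E <= e%:E)%E.
  have /fine_cvgP[fin fc] := c0.
  have N0 := cvgr_le _ fc _ e0.
  near \oo => n; exists n; rewrite -[leLHS]fineK; last by near: n; exact: fin.
  by rewrite lee_fin; near: n; exact: N0.
have [k [A [b [GA E]]]] := s'E n.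
by exists k, A, b; split => //; rewrite -E.
Unshelve. all: by end_near. Qed.

End SimpleApproximation.

(** * Approximation by finite martingales *)

Section CondexpMartingale.
Context {R : realType} {B : completeNormedModType R} (Omega : finType).
Variables (w : Omega -> R) (X : nat -> Omega -> Omega).
Hypothesis w0 : forall a, 0 <= w a.
Hypothesis Xref : forall n a b, X n.+1 a = X n.+1 b -> X n a = X n b.

Lemma condexp_sum_at {V : lmodType R} n (g : Omega -> V) (A : pred Omega) :
  measurable_at X n A ->
  \sum_(a | A a) w a *: condexp w X n g a = \sum_(a | A a) w a *: g a.
Proof.
move=> mA; rewrite (partition_big (X n) xpredT) //= [RHS](partition_big (X n) xpredT) //=.
by apply: eq_bigr => c _; rewrite !sum_class // condexp_sum_class.
Qed.

Lemma condexp_fmart (v : Omega -> B) : fmart w X (fun n => condexp w X n v).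
Proof.
split => //; first by move=> n a b /(condexp_class w) ->.
move=> n c; under eq_bigr do rewrite scalerBr.
rewrite sumrB condexp_sum_class // condexp_sum_at ?subrr //.
by move=> a b /Xref ->.
Qed.

End CondexpMartingale.

Section MartingaleApproximation.
Context {R : realType} {B : completeNormedModType R}.
Context {d : measure_display} {T : measurableType d}.
Variable P : probability T R.

Lemma integral_partition (Omega : finType) (H : T -> Omega) (u : T -> \bar R) :
  (forall i, measurable (H @^-1` [set i])) -> measurable_fun setT u ->
  (forall x, 0 <= u x)%E ->
  (\int[P]_x u x = \sum_i \int[P]_(x in H @^-1` [set i]) u x)%E.
Proof.
move=> mH mu u0.
have -> : [set: T] = \big[setU/set0]_(i <- enum Omega) (H @^-1` [set i]).
  apply/seteqP; split => x // _; rewrite -bigcup_seq.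
  by exists (H x) => //=; rewrite mem_enum.
rewrite ge0_integral_bigsetU ?enum_uniq //; first by rewrite big_enum.
- by move=> i j _ _ [x [/= <- <-]].
- exact: measurable_funS mu.
Qed.

Lemma sqr_div_le_integral (D : set T) (u : T -> R) (a : R) : measurable D ->
  measurable_fun D u -> (forall x, 0 <= u x) -> 0 <= a -> 0 < pr P D ->
  (a%:E <= \int[P]_(x in D) (u x)%:E)%E ->
  ((a ^+ 2 / pr P D)%:E <= \int[P]_(x in D) (u x ^+ 2)%:E)%E.
Proof.
move=> mD mu u0 a0 w0 au; set w := pr P D; set t := a / w.
have t0 : 0 <= t by rewrite divr_ge0 // ltW.
have mu2 : measurable_fun D (fun x => (u x ^+ 2)%:E).
  by apply/measurable_EFinP; exact: measurable_funX.
have H : ((2 * t * a)%:E <= (t ^+ 2 * w)%:E + \int[P]_(x in D) (u x ^+ 2)%:E)%E.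
  apply: (@le_trans _ _ (\int[P]_(x in D) (2 * t * u x)%:E)%E).
    under eq_integral do rewrite EFinM.
    have mu' : measurable_fun D (fun x => (u x)%:E) by exact/measurable_EFinP.
    have t20 : 0 <= 2 * t by rewrite mulr_ge0.
    have u0' x : D x -> (0 <= (u x)%:E)%E by rewrite lee_fin.
    rewrite ge0_integralZl_EFin // EFinM.
    by apply: lee_pmul => //; rewrite lee_fin.
  have -> : ((t ^+ 2 * w)%:E = \int[P]_(x in D) (t ^+ 2)%:E)%E.
    by rewrite integral_cst // prE // EFinM.
  have sq0 (y : R) : (0 <= (y ^+ 2)%:E)%E by rewrite lee_fin sqr_ge0.
  rewrite -ge0_integralD //.
  apply: ge0_le_integral; first exact: mD.
  - by move=> x _; rewrite lee_fin; apply: mulr_ge0 => //; apply: mulr_ge0.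
  - by apply/measurable_EFinP; apply: measurable_funM => //; exact: measurable_cst.
  - by apply: emeasurable_funD => //; exact: measurable_cst.
  - move=> x _; rewrite -EFinD lee_fin.
    by have := sqr_ge0 (t - u x); rewrite sqrrB; lra.
have E : 2 * t * a = t ^+ 2 * w + a ^+ 2 / w.
  by rewrite /t; field; rewrite gt_eqF.
have I0 : (0 <= \int[P]_(x in D) (u x ^+ 2)%:E)%E.
  by apply: integral_ge0 => x _; rewrite lee_fin sqr_ge0.
move: H I0; rewrite E EFinD; case: (\int[P]_(x in D) _)%E => [r||] //.
  by move=> + _; rewrite -!EFinD !lee_fin lerD2l.
by move=> _ _; rewrite leey.
Qed.

Lemma martingale_chain F (f : nat -> T -> B) n m A :
  filtration F -> martingale P F f -> (n <= m)%N -> F n A ->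
  exists v, is_bochner_integral P A (f n) v /\ is_bochner_integral P A (f m) v.
Proof.
move=> [_ [_ Fi]] [_ [_ M]] nm FA.
have FmA k : (n <= k)%N -> F k A.
  elim: k => [|k IH]; first by rewrite leqn0 => /eqP <-.
  by rewrite leq_eqVlt => /predU1P[<-//|]; rewrite ltnS => /IH /Fi.
elim: m nm => [|m IH].
  rewrite leqn0 => /eqP <-; have [v [v1 _]] := M n A FA.
  by exists v.
rewrite leq_eqVlt => /predU1P[<-|].
  by have [v [v1 _]] := M n A FA; exists v.
rewrite ltnS => nm; have [v [v1 v2]] := IH nm.
have [v' [v'1 v'2]] := M m A (FmA m nm).
by exists v; split => //; rewrite (bochner_unique v2 v'1).
Qed.

Lemma filtration_le (F : nat -> set (set T)) n m : filtration F -> (n <= m)%N -> F n `<=` F m.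
Proof.
move=> [_ [_ Fi]]; elim: m => [|m IH]; first by rewrite leqn0 => /eqP ->.
by rewrite leq_eqVlt => /predU1P[->//|]; rewrite ltnS => /IH h A /h /Fi.
Qed.

(* [Omega] records the membership bits of the finitely many sets occurring in
   simple approximations of [f 0, ..., f N], and [g n] is the conditional
   expectation of [f N] given the bits of the sets used up to time [n]. *)
Lemma martingale_approx F (f : nat -> T -> B) N eta :
  filtration F -> martingale P F f -> 0 < eta ->
  exists (Omega : finType) (H : T -> Omega) (X : nat -> Omega -> Omega)
    (g : nat -> Omega -> B),
  [/\ forall i, measurable (H @^-1` [set i]),
      fmart (fun i => pr P (H @^-1` [set i])) X g,
      forall n, (n <= N)%N -> (\int[P]_x (`|f n x - g n (H x)|)%:E <= eta%:E)%E &
      ((\sum_i pr P (H @^-1` [set i]) * `|g N i| ^+ 2)%:E <=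
        \int[P]_x (`|f N x| ^+ 2)%:E)%E].
Proof.
move=> Ff Mf eta0; have [Fs [Fm Fi]] := Ff; have [Ms [Mi M]] := Mf.
have mf n : strongly_measurable measurable (f n).
  exact: strongly_measurable_sub (Fm n) (Ms n).
have fi n : (\int[P]_x (`|f n x|)%:E < +oo)%E.
  by have [v /bochner_integrable] := Mi n.
have e20 : 0 < eta / 2 by rewrite divr_gt0.
have /choice[S HS] : forall n, exists S : {k & (('I_k -> set T) * ('I_k -> B))%type},
    (forall i, F n ((projT2 S).1 i)) /\
    (\int[P]_x (`|f n x - simple_fun (projT2 S).1 (projT2 S).2 x|)%:E <= (eta / 2)%:E)%E.
  move=> n; have [k [A [b [FA H]]]] := L1_simple_approx (Fs n) (Fm n) (Ms n) (fi n) e20.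
  by exists (existT _ k (A, b)).
pose k n := projT1 (S n).
pose A n : 'I_(k n) -> set T := (projT2 (S n)).1.
pose b n : 'I_(k n) -> B := (projT2 (S n)).2.
have FA n i : F n (A n i) by have [+ _] := HS n; exact.
have SA n : (\int[P]_x (`|f n x - simple_fun (A n) (b n) x|)%:E <= (eta / 2)%:E)%E.
  by have [] := HS n.
pose J : finType := {n : 'I_N.+1 & 'I_(k n)}.
pose AA (j : J) := A (tag j) (tagged j).
pose Omega : finType := {ffun J -> bool}.
pose H x : Omega := [ffun j => x \in AA j].
pose X n (omega : Omega) : Omega := [ffun j : J => (tag j <= n)%N && omega j].
have FX n c : (n <= N)%N -> F n ((fun x => X n (H x)) @^-1` [set c]).
  move=> nN; pose AA' (j : J) : set (g_sigma_algebraType (F n)) :=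
    if (tag j <= n)%N then AA j else set0.
  have mAA' j : measurable (AA' j).
    rewrite measurable_g_measurableTypeE // /AA'; case: ifP => [jn|_].
      by apply: (filtration_le Ff jn); exact: FA.
    by have [] := Fs n.
  have := measurable_bits mAA' c.
  rewrite measurable_g_measurableTypeE //.
  congr (F n _); apply: (congr1 (fun h => h @^-1` [set c])).
  apply/funext => x; apply/ffunP => j; rewrite !ffunE /AA'.
  by case: ifP => //= _; rewrite in_set0.
have XN omega : X N omega = omega.
  by apply/ffunP => j; rewrite ffunE -ltnS ltn_ord.
have FH c : F N (H @^-1` [set c]).
  have := FX N c (leqnn N); congr (F N _).
  by apply/seteqP; split=> x /=; rewrite XN.
have mH c : measurable (H @^-1` [set c]) by exact/(Fm N)/FH.
have Xref n a c : X n.+1 a = X n.+1 c -> X n a = X n c.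
  move=> /ffunP E; apply/ffunP => j; have := E j; rewrite !ffunE.
  by case: (leqP (tag j) n) => // jn; rewrite (leqW jn).
have /choice[m Hm] : forall i, exists v, is_bochner_integral P (H @^-1` [set i]) (f N) v.
  by move=> i; have [v [v1 _]] := M N _ (FH i); exists v.
pose w i := pr P (H @^-1` [set i]).
have w0 i : 0 <= w i by exact: pr_ge0.
pose v i : B := (w i)^-1 *: m i.
have mv i : m i = w i *: v i.
  rewrite /v scalerA; have [wi0|wi0] := eqVneq (w i) 0; last by rewrite mulfV // scale1r.
  rewrite wi0 mul0r scale0r; apply/eqP; rewrite -normr_le0 -lee_fin.
  apply: le_trans (bochner_norm (Hm i)) _.
  rewrite null_set_integral //.
  - by apply/measurable_EFinP; exact: measurable_norm.
  - by have := prE P (mH i); rewrite -/(w i) wi0.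
pose g n := condexp w X n v.
have fmg : fmart w X g by exact: condexp_fmart.
exists Omega, H, X, g; split => //.
- move=> n nN; pose nn := Ordinal (nN : (n < N.+1)%N).
  pose sg (omega : Omega) : B := \sum_(i < k n) (omega (Tagged (fun n : 'I_N.+1 => 'I_(k n)) (i : 'I_(k nn))))%:R *: b n i.
  have sgE : simple_fun (A n) (b n) = sg \o H.
    by apply/funext => x; apply: eq_bigr => i _; rewrite ffunE.
  have ms : strongly_measurable measurable (simple_fun (A n) (b n)).
    by apply: simple_fun_strongly_measurable => i; exact/(Fm n)/FA.
  have mgH : strongly_measurable measurable (g n \o H) by exact: strongly_measurable_fin.
  have sgX a c : X n a = X n c -> sg a = sg c.
    move=> /ffunP E; apply: eq_bigr => i _.
    by have := E (Tagged (fun n : 'I_N.+1 => 'I_(k n)) (i : 'I_(k nn))); rewrite !ffunE /= leqnn /= => ->.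
  apply: le_trans (integral_norm_triangle P measurableT (mf n) mgH ms) _.
  have -> : (eta%:E = (eta / 2)%:E + (eta / 2)%:E)%E by rewrite -EFinD -splitr.
  apply: leeD; first exact: SA.
  apply: (@le_trans _ _ (\int[P]_x (`|f n x - simple_fun (A n) (b n) x|)%:E)%E); last exact: SA.
  rewrite sgE /= (expectation_fin P mH (g := fun i => `|sg i - g n i|)) //.
  have mXH c : measurable ((fun x => X n (H x)) @^-1` [set c]).
    by apply: (Fm n); exact: FX.
  rewrite (integral_partition mXH); last 2 first.
  - apply/measurable_EFinP; apply: measurable_norm_sub => //.
    by have := ms; rewrite sgE.
  - by move=> x; rewrite lee_fin.
  rewrite (partition_big (X n) xpredT) //= -sumEFin; apply: lee_sum => c _.
  case: (pickP (fun a => X n a == c)) => [a0 /eqP Xa0|no]; last first.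
    by rewrite big_pred0 //; apply: integral_ge0 => x _; rewrite lee_fin.
  set Dc := (fun x => X n (H x)) @^-1` [set c].
  have DcE : Dc = H @^-1` [set a | X n a == c].
    by apply/seteqP; split=> x /= => [->|/eqP].
  have [V [V1 V2]] := martingale_chain Ff Mf nN (FX n c nN).
  have [v0 Hv0] := Mi N.
  have VE : V = \sum_(a | X n a == c) w a *: v a.
    under eq_bigr do rewrite -mv.
    rewrite -/Dc DcE in V2.
    exact: (bochner_additive mH Hv0 V2 Hm).
  have FAm i : measurable (A n i) by exact/(Fm n)/FA.
  have := bochner_dist (b n) V1 FAm; rewrite -/Dc sgE /= => /(le_trans _); apply.
  have IE : simple_integral P Dc (A n) (b n) = \sum_(a | X n a == c) w a *: sg a.
    rewrite (@simple_integral_fin _ _ _ _ P _ H Dc (k n) (A n) (b n)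
      (fun i omega => omega (Tagged (fun n : 'I_N.+1 => 'I_(k n)) (i : 'I_(k nn))))) //; last first.
    - by move=> i x; rewrite ffunE.
    - exact: mXH.
    rewrite [RHS]big_mkcond; apply: eq_bigr => a _ /=; rewrite DcE -/(sg a).
    case: ifPn => Xa.
      congr (pr P _ *: _); apply/seteqP; split=> x /= => [[]//|Hx].
      by rewrite Hx.
    rewrite (_ : _ `&` _ = set0) ?/pr ?measure0 ?scale0r //.
    by apply/seteqP; split=> x //= -[->]; exact/negP.
  rewrite lee_fin IE.
  rewrite VE -(condexp_sum_class X w0 n v c) -/(g n) -sumrB.
  have -> : \sum_(a | X n a == c) pr P (H @^-1` [set a]) * `|sg a - g n a| =
      `|\sum_(a | X n a == c) (w a *: g n a - w a *: sg a)|.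
    have E a : X n a == c -> g n a - sg a = g n a0 - sg a0.
      move=> /eqP Xa; rewrite (sgX a a0) ?Xa // (fm_adapted fmg (n := n) (b := a0)) ?Xa //.
    rewrite (eq_bigr (fun a => w a * `|g n a0 - sg a0|)); last first.
      by move=> a /E Ea; rewrite distrC Ea.
    rewrite [in RHS](eq_bigr (fun a => w a *: (g n a0 - sg a0))); last first.
      by move=> a /E <-; rewrite scalerBr.
    by rewrite -mulr_suml -scaler_suml normrZ ger0_norm // sumr_ge0.
  by [].
- rewrite (integral_partition mH); last 2 first.
  - by apply/measurable_EFinP; apply: measurable_funX; exact: measurable_norm.
  - by move=> x; rewrite lee_fin sqr_ge0.
  rewrite -sumEFin; apply: lee_sum => i _; rewrite -/(w i).
  have [wi0|wi0] := eqVneq (w i) 0.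
    by rewrite wi0 mul0r; apply: integral_ge0 => x _; rewrite lee_fin sqr_ge0.
  have gE : g N i = (w i)^-1 *: m i.
    rewrite /g /condexp !XN.
    have E a : (X N a == i) = (a == i) by rewrite XN.
    by rewrite !(eq_bigl _ _ E) !big_pred1_eq mv.
  rewrite gE normrZ normfV (ger0_norm (w0 i)).
  have -> : w i * ((w i)^-1 * `|m i|) ^+ 2 = `|m i| ^+ 2 / w i by field.
  apply: sqr_div_le_integral => //.
  - exact: measurable_norm.
  - by rewrite -/(w i) lt_neqAle eq_sym wi0 w0.
  - exact: bochner_norm (Hm i).
Qed.

End MartingaleApproximation.

(** * Concatenation of independent finite martingales *)

Section IndependentSequence.
Context {R : realType}.

Lemma cut_unit_interval (Omega : finType) (p : Omega -> R) :
  (forall i, 0 <= p i) -> \sum_i p i = 1 ->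
  exists (c : Omega -> R) (iota : R -> Omega),
    (forall i, 0 <= c i /\ c i + p i <= 1) /\
    (forall x i, 0 <= x < 1 -> (iota x == i) = (c i <= x < c i + p i)).
Proof.
move=> p0 p1; pose m := #|Omega|.
pose s n : R := \sum_(j < m | (j < n)%N) p (enum_val j).
have s_le n n' : (n <= n')%N -> s n <= s n'.
  move=> nn'; rewrite /s [leLHS]big_mkcond [leRHS]big_mkcond; apply: ler_sum => j _.
  by case: ifP => [jn|_]; [rewrite (leq_trans jn nn')|case: ifP].
have sm n : (m <= n)%N -> s n = 1.
  move=> mn; rewrite -p1 (reindex _ (onW_bij _ (@enum_val_bij Omega))).
  by apply: eq_bigl => j; rewrite (leq_trans (ltn_ord j) mn).
have s0 : s 0%N = 0 by rewrite /s big_pred0.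
have sS (i : Omega) : s (enum_rank i).+1 = s (enum_rank i) + p i.
  rewrite /s (bigD1 (enum_rank i)) //= enum_rankK addrC; congr (_ + _).
  by apply: eq_bigl => j; rewrite ltnS ltn_neqAle andbC.
pose c (i : Omega) := s (enum_rank i).
have i0 : Omega.
  case: (pickP (fun _ : Omega => true)) => [i //|no].
  by move: p1; rewrite big_pred0 // => /esym/eqP; rewrite oner_eq0.
pose iota x := odflt i0 [pick i | c i <= x < c i + p i].
have uniq (x : R) i j : c i <= x < c i + p i -> c j <= x < c j + p j -> i = j.
  suff H i' j' : (enum_rank i' < enum_rank j')%N -> x < c i' + p i' -> c j' <= x -> False.
    move=> /andP[a1 a2] /andP[b1 b2].
    case: (ltngtP (enum_rank i) (enum_rank j)) => [/H/(_ a2 b1)//|/H/(_ b2 a1)//|].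
    by move=> /val_inj/enum_rank_inj.
  by rewrite /c -sS => /s_le h h1 h2; have := le_lt_trans (le_trans h h2) h1; rewrite ltxx.
exists c, iota; split.
  move=> i; rewrite /c -sS -{1}s0 s_le //; split => //.
  by rewrite -(sm m (leqnn m)) s_le.
move=> x i /andP[x0 x1].
have [k ck] : exists k, c k <= x < c k + p k.
  have ex : exists n, x < s n by exists m; rewrite sm.
  case: (ex_minnP ex) => -[|n] xn nmin; first by move: xn; rewrite s0 ltNge x0.
  have nm : (n < m)%N.
    by rewrite ltnNge; apply/negP => mn; have := nmin m; rewrite sm // => /(_ x1); rewrite leqNgt ltnS mn.
  exists (enum_val (Ordinal nm)); rewrite /c -sS enum_valK /= xn andbT.
  by rewrite leNgt; apply/negP => /nmin; rewrite ltnn.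
rewrite /iota; case: pickP => [j cj|/(_ k)]; last by rewrite ck.
by apply/eqP/idP => [<- //|ci]; exact: (uniq x).
Qed.

Variables (Omega : nat -> finType) (p : forall k, Omega k -> R).

Fixpoint history k : finType :=
  if k is k'.+1 then (history k' * Omega k')%type : finType else unit.

Fixpoint history_weight k : history k -> R :=
  if k is k'.+1 then fun a => history_weight a.1 * p a.2 else fun=> 1.

Fixpoint history_of {T : Type} (om : forall k, T -> Omega k) k (x : T) : history k :=
  if k is k'.+1 return history k then (history_of om k' x, om k' x) else tt.

Hypothesis p0 : forall k i, 0 <= p (k := k) i.
Hypothesis p1 : forall k, \sum_(i : Omega k) p i = 1.

Lemma history_weight_ge0 k (a : history k) : 0 <= history_weight a.
Proof. by elim: k a => [|k IH] //= [a b] /=; rewrite mulr_ge0. Qed.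

Lemma history_weight_sum k : \sum_(a : history k) history_weight a = 1.
Proof.
elim: k => [|k IH] /=; first by rewrite big_const /= card_unit /= addr0.
rewrite -(pair_bigA _ (fun (a : history k) b => history_weight a * p b)) /=.
by under eq_bigr do rewrite -mulr_sumr p1 mulr1.
Qed.

Section Intervals.
Variables (c : forall k, Omega k -> R) (iota : forall k, R -> Omega k).
Hypothesis cP : forall k i, 0 <= c (k := k) i /\ c i + p i <= 1.
Hypothesis iotaP : forall k x i, 0 <= x < 1 ->
  (iota k x == i) = (c i <= x < c i + p i).

(* The k-th choice subdivides the current subinterval of [0, 1[ in proportion
   to the weights, so that the histories of length k correspond to the atoms
   of a partition into intervals whose lengths are the history weights. *)
Fixpoint history_left k : history k -> R :=
  if k is k'.+1 then
    fun a => history_left a.1 + history_weight a.1 * c a.2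
  else fun=> 0.

Fixpoint coded_history k (x : R) : history k :=
  if k is k'.+1 return history k then
    let a := coded_history k' x in
    (a, iota k' ((x - history_left a) / history_weight a))
  else tt.

Lemma history_left_bounds k (a : history k) :
  0 <= history_left a /\ history_left a + history_weight a <= 1.
Proof.
elim: k a => [|k IH] /=; first by rewrite add0r.
move=> [a b] /=; have [l0 l1] := IH a; have [c0 c1] := cP b.
have w0 := history_weight_ge0 a; split; first by rewrite addr_ge0 // mulr_ge0.
apply: le_trans l1; rewrite -addrA lerD2l -mulrDr.
by rewrite ler_piMr.
Qed.

Lemma coded_historyP k (a : history k) x : 0 <= x < 1 ->
  (coded_history k x == a) =
  (history_left a <= x < history_left a + history_weight a).
Proof.
move=> x01; elim: k a => [|k IH] /=; first by case; rewrite add0r x01.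
move=> [a b] /=; rewrite xpair_eqE.
have [c0 c1] := cP b; have w0 := history_weight_ge0 a.
have [wa0|wa0] := eqVneq (history_weight a) 0.
  rewrite IH wa0 !mul0r !addr0.
  have -> : (history_left a <= x < history_left a) = false.
    by apply/negbTE/negP => /andP[/le_lt_trans h /h]; rewrite ltxx.
  by [].
have wp : 0 < history_weight a by rewrite lt_neqAle eq_sym wa0 w0.
set l := history_left a; set w := history_weight a.
have E1 (z : R) : (l + w * z <= x) = (z <= (x - l) / w).
  by rewrite ler_pdivlMr // lerBrDl mulrC.
have E2 (z : R) : (x < l + w * z) = ((x - l) / w < z).
  by rewrite ltr_pdivrMr // ltrBlDl mulrC.
rewrite -[X in _ = (_ <= _ < X)]addrA -mulrDr E1 E2.
case: eqP => [ca|nca] /=.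
  rewrite ca -/l -/w iotaP //.
  have /esym := IH a; rewrite ca eqxx => /andP[h1 h2].
  by rewrite -E2 mulr1 h2 andbT divr_ge0 ?subr_ge0 // ltW.
apply/esym/negP => /andP[h1 h2]; apply: nca; apply/eqP; rewrite IH.
have := E1 0; rewrite mulr0 addr0 => ->.
have := E2 1; rewrite mulr1 => ->; rewrite (le_trans c0 h1) /=.
exact: lt_le_trans h2 c1.
Qed.

End Intervals.

Lemma uniform_prob_itv (a b : R) : 0 <= a -> a <= b -> b <= 1 ->
  uniform_prob (@ltr01 R) `[a, b[ = (b - a)%:E.
Proof.
move=> a0 ab b1; rewrite /uniform_prob.
rewrite (eq_integral (cst 1%:E)) => [|x]; last first.
  rewrite inE /= in_itv /= => /andP[ax xb]; rewrite /uniform_pdf.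
  by rewrite (le_trans a0 ax) (ltW (lt_le_trans xb b1)) /= subr0 invr1.
rewrite integral_cst //= mul1e lebesgue_measure_itv /= lte_fin.
case: ltP => [_|ba]; first by rewrite EFinB.
by have -> : a = b; [apply/eqP; rewrite eq_le ab ba|rewrite subrr].
Qed.

Lemma independent_sequence :
  exists (d : measure_display) (T : measurableType d) (P : probability T R)
    (om : forall k, T -> Omega k), forall k (a : history k),
    measurable (history_of om k @^-1` [set a]) /\
    pr P (history_of om k @^-1` [set a]) = history_weight a.
Proof.
have H k := cut_unit_interval (p0 (k := k)) (p1 k).
pose c k := projT1 (cid (H k)).
have H1 k := projT2 (cid (H k)).
pose io k := projT1 (cid (H1 k)).
have cP k (i : Omega k) : 0 <= c k i /\ c k i + p i <= 1.
  by have [h _] := projT2 (cid (H1 k)); exact: h.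
have ioP k x (i : Omega k) : 0 <= x < 1 -> (io k x == i) = (c k i <= x < c k i + p i).
  by have [_ h] := projT2 (cid (H1 k)); exact: h.
pose r (x : R) : R := if 0 <= x < 1 then x else 0.
have r01 x : 0 <= r x < 1 by rewrite /r; case: ifP => // _; rewrite lexx ltr01.
pose ch k x := coded_history c io k x.
pose om k x := io k ((r x - history_left c (ch k (r x))) / history_weight (ch k (r x))).
have omE k x : history_of om k x = ch k (r x).
  by elim: k => [|k IH] //=; rewrite IH.
exists _, _, (uniform_prob (@ltr01 R) : probability _ R), om => k a.
set A := history_of om k @^-1` [set a].
pose I := `[history_left c a, history_left c a + history_weight a[%classic.
have [l0 l1] := history_left_bounds cP a.
have IE : A `&` `[0, 1[ = I.
  apply/seteqP; split => x /=; rewrite /I /= !in_itv /=.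
    move=> [Ax x01]; have := coded_historyP cP ioP a x01.
    by rewrite -[coded_history _ _ _ _]/(ch k x) -[X in ch k X](_ : r x = x) ?omE /r ?x01 // -Ax omE /r x01 eqxx.
  move=> xI; have x01 : 0 <= x < 1.
    by case/andP: xI => h1 h2; rewrite (le_trans l0 h1) (lt_le_trans h2 l1).
  split => //; apply/eqP; rewrite omE /r x01.
  by rewrite (coded_historyP cP ioP a x01).
have AE : A = I `|` (if ch k 0 == a then ~` `[0, 1[%classic else set0).
  rewrite -IE; apply/seteqP; split => x.
    case: (boolP (0 <= x < 1)) => [x01 Ax|x01 Ax]; first by left; split => //=; rewrite in_itv.
    right; move: Ax; rewrite /A /= omE /r (negbTE x01) => ->; rewrite eqxx /=.
    by rewrite in_itv /=; exact/negP.
  case=> [[]//|]; case: eqP => //= ca; rewrite in_itv /= => /negP x01.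
  by rewrite /A /= omE /r (negbTE x01).
have mC : measurable (if ch k 0 == a then ~` `[0, 1[%classic else set0 : set (measurableTypeR R)).
  by case: ifP => // _; apply: measurableC; exact: measurable_itv.
have mI : measurable (I : set (measurableTypeR R)) by exact: measurable_itv.
split; first by rewrite AE; exact: measurableU.
rewrite AE /pr measureU //; last first.
  apply/seteqP; split => x //= [Ix]; case: ifP => //= _.
  by move=> nx; move: Ix; rewrite -IE => -[_ /nx].
rewrite [X in (_ + X)%E](_ : _ = 0%E); last first.
  case: ifP => _; last by rewrite measure0.
  have e := uniform_prob_itv (lexx 0) ler01 (lexx 1).
  apply: etrans (probability_setC (uniform_prob (@ltr01 R) : probability _ R)
    (measurable_itv `[0, 1[)) _.
  rewrite [X in (1 - X)%E](_ : _ = 1%:E) ?subee //.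
  by have := e; rewrite subr0.
have lw : history_left c a <= history_left c a + history_weight a.
  by rewrite lerDl history_weight_ge0.
rewrite adde0; have /(congr1 fine) := uniform_prob_itv l0 lw l1.
by rewrite addrAC subrr add0r.
Qed.

End IndependentSequence.

Section Concatenation.
Context {R : realType} {B : completeNormedModType R}.
Variables (Omega : nat -> finType) (p : forall k, Omega k -> R).
Variables (X : forall k, nat -> Omega k -> Omega k).
Variables (f : forall k, nat -> Omega k -> B) (N : nat -> nat).
Hypothesis fmf : forall k, fmart (p (k := k)) (X (k := k)) (f (k := k)).
Hypothesis f0 : forall k a, f (k := k) 0 a = 0.
Hypothesis p1 : forall k, \sum_(i : Omega k) p i = 1.

Let p0 k i : 0 <= p (k := k) i := fm_ge0 (fmf k) i.

Context {d : measure_display} {T : measurableType d}.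
Variables (P : probability T R) (om : forall k, T -> Omega k).
Hypothesis omP : forall k (a : history Omega k),
  measurable (history_of om k @^-1` [set a]) /\
  pr P (history_of om k @^-1` [set a]) = history_weight p a.

(* [position n = (k, t)]: at time [n] the k-th block has run for [t] of its
   [N k] steps; passing to the next block takes one (idle) time step. *)
Fixpoint position n : nat * nat :=
  if n is n'.+1 then
    let: (k, t) := position n' in if (t < N k)%N then (k, t.+1) else (k.+1, 0%N)
  else (0%N, 0%N).

Fixpoint history_sum k : history Omega k -> B :=
  if k is k'.+1 then fun a => history_sum a.1 + f (N k') a.2 else fun=> 0.

Definition stage k t (a : history Omega k.+1) : B := history_sum a.1 + f t a.2.

Definition concat n x : B :=
  stage (position n).2 (history_of om (position n).1.+1 x).

Definition info k t x : history Omega k * Omega k := (history_of om k x, X t (om k x)).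

(* The sigma-algebra generated by the finite-valued map [info], presented as
   the family of sets invariant under its fibers. *)
Definition concat_filtration n (A : set T) :=
  forall x y, info (position n).1 (position n).2 x = info (position n).1 (position n).2 y ->
    A x -> A y.

Lemma position_le n : ((position n).2 <= N (position n).1)%N.
Proof.
elim: n => [|n IH] //=; case: (position n) IH => k t /= _.
by case: ifP.
Qed.

Lemma info_refine n x y :
  info (position n.+1).1 (position n.+1).2 x = info (position n.+1).1 (position n.+1).2 y ->
  info (position n).1 (position n).2 x = info (position n).1 (position n).2 y.
Proof.
rewrite /=; case: (position n) => k t; case: ifP => _ /= [].
  by rewrite /info => -> /(fm_refine (fmf k)) ->.
by rewrite /info => -> -> _.
Qed.

Let mhist k a : measurable (history_of om k @^-1` [set a]).
Proof. by have [] := omP a. Qed.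

Definition info_image k t (A : set T) (a : history Omega k.+1) : bool :=
  `[< exists x, A x /\ info k t x = (a.1, X t a.2) >].

Lemma concat_filtration_preim n A : concat_filtration n A ->
  A = history_of om (position n).1.+1 @^-1`
    [set a | info_image (position n).2 A a].
Proof.
move=> FA; apply/seteqP; split => x /=.
  by move=> Ax; apply/asboolP; exists x.
by move=> /asboolP[y [Ay yx]]; apply: FA Ay; rewrite yx.
Qed.

Lemma concat_filtrationP : filtration concat_filtration.
Proof.
split; [|split].
- move=> n; split.
  + by move=> x y.
  + by move=> A FA x y xy [_ nAx]; split => // Ay; apply: nAx; exact: FA Ay.
  + by move=> A FA x y xy [i _ Aix]; exists i => //; exact: FA Aix.
- move=> n A /concat_filtration_preim ->; apply: measurable_preim_fin.
  exact: mhist.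
- by move=> n A FA x y /info_refine; exact: FA.
Qed.

Lemma concat_strongly_measurable n : strongly_measurable (concat_filtration n) (concat n).
Proof.
apply: simple_strongly_measurable; rewrite /concat /concat_filtration.
case: (position n) => k t /=.
pose g (i : history Omega k * Omega k) := history_sum i.1 +
  (if [pick b | X t b == i.2] is Some b then f t b else 0).
have -> : (fun x => stage t (history_of om k.+1 x)) = g \o info k t.
  apply/funext => x; rewrite /stage /g /=; congr (_ + _).
  case: pickP => [b /eqP Xb|/(_ (om k x))]; last by rewrite eqxx.
  by apply: (fm_adapted (fmf k)).
apply: simple_fin => i x y /= xy <-; exact: esym.
Qed.

Lemma concat_bochner n A : concat_filtration n A ->
  exists v, is_bochner_integral P A (concat n) v /\
            is_bochner_integral P A (concat n.+1) v.
Proof.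
move=> FA; rewrite (concat_filtration_preim FA); move: (position_le n).
rewrite /concat /=; case: (position n) => k t /= tN.
set Y := @info_image k t A.
have YX (a : history Omega k) b b' : X t b = X t b' -> Y (a, b) = Y (a, b').
  by rewrite /Y /info_image /= => ->.
have mh := mhist (k := k.+1).
case: ifPn => /= [tN'|].
  exists (\sum_(i | Y i) pr P (history_of om k.+1 @^-1` [set i]) *: stage t i); split.
    exact: (bochner_fin P (stage t) Y mh).
  have -> : \sum_(i | Y i) pr P (history_of om k.+1 @^-1` [set i]) *: stage t i =
     \sum_(i | Y i) pr P (history_of om k.+1 @^-1` [set i]) *: stage t.+1 i.
    apply/esym/eqP; rewrite -subr_eq0 -sumrB; apply/eqP.
    under eq_bigr => i _.
      rewrite (proj2 (omP (k := k.+1) i)) -scalerBr /stage opprD addrACA subrr add0r; over.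
    rewrite big_mkcond /=.
    rewrite -(pair_bigA _ (fun a b => if Y (a, b) then
      (history_weight p a * p b) *: (f t.+1 b - f t b) else 0)) /=.
    apply: big1 => a _; rewrite -big_mkcond /=.
    under eq_bigr do rewrite -scalerA.
    rewrite -scaler_sumr.
    rewrite (partition_big (X t) xpredT) //= big1 ?scaler0 // => c _.
    rewrite (sum_class (A := fun b => Y (a, b))); last by move=> b b' /YX ->.
    by case: ifP => // _; exact: fm_mean (fmf k) t c.
  exact: (bochner_fin P (stage t.+1) Y mh).
rewrite -leqNgt => Nt; have {Nt tN} -> : t = N k by apply/eqP; rewrite eqn_leq tN Nt.
exists (\sum_(i | Y i) pr P (history_of om k.+1 @^-1` [set i]) *: stage (N k) i).
have H := bochner_fin P (stage (N k)) Y mh.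
split; first exact: H.
rewrite (_ : (fun x => _) = stage (N k) \o history_of om k.+1) //.
by apply/funext => x; rewrite /stage /= f0 addr0.
Qed.

Lemma concat_martingale : martingale P concat_filtration concat.
Proof.
split; first exact: concat_strongly_measurable.
split; last exact: concat_bochner.
move=> n; have FT : concat_filtration n setT by [].
by have [v [v1 _]] := concat_bochner FT; exists v.
Qed.

Lemma concat_Sq_ge (q : R) J : exists M, forall x,
  \sum_(j < J) lqsum q (f (k := j)) (N j) (om j x) <=
  \sum_(n < M) `|mdiff concat n x| `^ q.
Proof.
suff [M [_ H]] : exists M, position M = (J, 0%N) /\ forall x,
    \sum_(j < J) lqsum q (f (k := j)) (N j) (om j x) <=
    \sum_(n < M.+1) `|mdiff concat n x| `^ q by exists M.+1.
elim: J => [|J [M [pM HM]]].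
  by exists 0%N; split => // x; rewrite big_ord0 sumr_ge0 // => i _; exact: powR_ge0.
have H s : (s <= N J)%N -> position (M + s) = (J, s) /\ forall x,
    \sum_(j < J) lqsum q (f (k := j)) (N j) (om j x) + lqsum q (f (k := J)) s (om J x) <=
    \sum_(n < (M + s).+1) `|mdiff concat n x| `^ q.
  elim: s => [_|s IH sN].
    rewrite addn0 pM; split => // x.
    by rewrite {2}/lqsum big_ord0 addr0.
  have [ps Hs] := IH (ltnW sN).
  have pS : position (M + s.+1) = (J, s.+1) by rewrite addnS /= ps sN.
  split => // x; rewrite addnS big_ord_recr /= lqsumS addrA lerD //.
  rewrite /concat -addnS ps pS /= /stage /=.
  by rewrite opprD addrACA subrr add0r.
have [ps Hs] := H (N J) (leqnn _).
exists (M + N J).+1; split; first by rewrite /= ps ltnn.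
move=> x; rewrite !big_ord_recr /= -[leLHS]addr0 lerD ?powR_ge0 //.
by have := Hs x; rewrite big_ord_recr.
Qed.

Lemma concat_norm_le n :
  (\int[P]_x (`|concat n x|)%:E <=
    (\sum_(j < (position n).1.+1) \sum_b p b * `|f (k := j) (N j) b|)%:E)%E.
Proof.
have E := expectation_fin P (mhist (k := (position n).1.+1))
  (g := fun i => `|stage (position n).2 i|).
rewrite /concat E // lee_fin => {E}.
have tN := position_le n.
case: (position n) tN => k t /= tN.
under eq_bigr => i _ do rewrite (proj2 (omP (k := k.+1) i)).
apply: (@le_trans _ _ (\sum_(i : history Omega k.+1) history_weight p i *
   (`|history_sum i.1| + `|f t i.2|))).
  apply: ler_sum => i _; apply: ler_wpM2l; first exact: history_weight_ge0.
  exact: ler_normD.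
have prodE k' (u : history Omega k' -> R) (v : Omega k' -> R) :
    \sum_(i : history Omega k'.+1) history_weight p i * (u i.1 + v i.2) =
    \sum_a history_weight p a * u a + \sum_b p b * v b.
  rewrite /= -(pair_bigA _ (fun a b => history_weight p a * p b * (u a + v b))) /=.
  under eq_bigr => a _.
    rewrite (eq_bigr (fun b => history_weight p a * u a * p b +
      history_weight p a * (p b * v b))) => [|b _]; last by ring.
    rewrite big_split /= -!mulr_sumr p1 mulr1; over.
  by rewrite big_split /= -mulr_suml history_weight_sum // mul1r.
rewrite (prodE k (fun a => `|history_sum a|) (fun b => `|f t b|)).
rewrite big_ord_recr /=; apply: lerD; last first.
  have := fm_norm_le (fmf k) tN (fun a b _ => erefl : predT a = predT b).
  exact.
elim: k t tN => [|k IH] t tN /=.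
  by rewrite big_ord0 big1 // => a _; rewrite normr0 mulr0.
apply: (@le_trans _ _ (\sum_(i : history Omega k.+1) history_weight p i *
   (`|history_sum i.1| + `|f (N k) i.2|))).
  apply: ler_sum => i _; apply: ler_wpM2l; first exact: (@history_weight_ge0 _ _ p p0 k.+1).
  exact: ler_normD.
rewrite (prodE k (fun a => `|history_sum a|) (fun b => `|f (N k) b|)).
rewrite big_ord_recr /= lerD2r; exact: (IH (N k)).
Qed.

End Concatenation.

(** * Partial square functions *)

Section LqComparison.
Context {R : realType}.
Implicit Types (q x y : R) (u v e : nat -> R).

Lemma powRD_ge q x y : 1 <= q -> 0 <= x -> 0 <= y ->
  x `^ q + y `^ q <= (x + y) `^ q.
Proof.
move=> q1 x0 y0; have q0 : 0 < q by lra.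
rewrite -!(@mulr_powRB1 _ _ q) ?addr_ge0 // mulrDl.
have q10 : 0 <= q - 1 by lra.
apply: lerD; apply: ler_wpM2l => //; apply: ge0_ler_powR => //;
  rewrite ?nnegrE ?addr_ge0 //; lra.
Qed.

Lemma sum_powR_le q v n : 1 <= q -> (forall k, 0 <= v k) ->
  \sum_(k < n) v k `^ q <= (\sum_(k < n) v k) `^ q.
Proof.
move=> q1 v0; elim: n => [|n IH].
  by rewrite !big_ord0 powR0 // gt_eqF //; lra.
rewrite !big_ord_recr /=; apply: le_trans (powRD_ge q1 _ (v0 n)).
  by rewrite lerD2r.
exact: sumr_ge0.
Qed.

Lemma powRDV_le q x y : 1 <= q -> 0 <= x -> 0 <= y ->
  (x + y) `^ q^-1 <= x `^ q^-1 + y `^ q^-1.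
Proof.
move=> q1 x0 y0; have q0 : 0 < q by lra.
rewrite -(ler_powR2r q0) ?addr_ge0 ?powR_ge0 // powRVK ?addr_ge0 //.
rewrite -{1}(powRVK q0 x0) -{1}(powRVK q0 y0).
by apply: powRD_ge; rewrite ?powR_ge0.
Qed.

Lemma lq_le_add q u v e n : 1 <= q -> (forall k, 0 <= u k) ->
  (forall k, 0 <= v k) -> (forall k, 0 <= e k) ->
  (forall k, (k < n)%N -> u k <= v k + e k) ->
  (\sum_(k < n) u k `^ q) `^ q^-1 <=
  2 * (\sum_(k < n) v k `^ q) `^ q^-1 + 2 * \sum_(k < n) e k.
Proof.
move=> q1 u0 v0 e0 uve; have q0 : 0 < q by lra.
have S0 (w : nat -> R) : 0 <= \sum_(k < n) w k `^ q.
  by apply: sumr_ge0 => k _; exact: powR_ge0.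
have E0 : 0 <= \sum_(k < n) e k by exact: sumr_ge0.
have H : \sum_(k < n) u k `^ q <=
    2 `^ q * (\sum_(k < n) v k `^ q + (\sum_(k < n) e k) `^ q).
  apply: (@le_trans _ _ (2 `^ q * (\sum_(k < n) v k `^ q + \sum_(k < n) e k `^ q))).
    rewrite -big_split mulr_sumr; apply: ler_sum => k _ /=.
    apply: le_trans (powRD_le q0 (v0 k) (e0 k)).
    by rewrite ler_powR2r ?addr_ge0 // uve.
  by rewrite ler_wpM2l ?powR_ge0 // lerD2l sum_powR_le.
have qi0 : 0 < q^-1 by rewrite invr_gt0.
apply: (@le_trans _ _ ((2 `^ q * (\sum_(k < n) v k `^ q + (\sum_(k < n) e k) `^ q)) `^ q^-1)).
  by rewrite ler_powR2r // mulr_ge0 ?powR_ge0 // addr_ge0 // powR_ge0.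
rewrite powRM ?addr_ge0 ?powR_ge0 // powRKV // -mulrDr ler_wpM2l //.
apply: le_trans (powRDV_le q1 (S0 v) (powR_ge0 _ _)) _.
by rewrite powRKV.
Qed.

End LqComparison.

Section PartialSquareFunction.
Context {R : realType} {B : completeNormedModType R}.
Context {d : measure_display} {T : measurableType d}.
Implicit Types (f : nat -> T -> B) (q : R).

Definition psum q f N x : R := \sum_(n < N) `|mdiff f n x| `^ q.

Definition pSq q f N x : R := psum q f N x `^ q^-1.

Lemma psum_ge0 q f N x : 0 <= psum q f N x.
Proof. by apply: sumr_ge0 => n _; exact: powR_ge0. Qed.

Lemma psum_le_series q f N x :
  ((psum q f N x)%:E <= \sum_(0 <= n <oo) ((`| mdiff f n x |) `^ q)%:E)%E.
Proof.
rewrite /psum -(big_mkord xpredT (fun n => `|mdiff f n x| `^ q)) -sumEFin.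
by apply: nneseries_lim_ge => n _ _; rewrite lee_fin powR_ge0.
Qed.

Lemma series_le q f x (y : R) : (forall N, psum q f N x <= y) ->
  (\sum_(0 <= n <oo) ((`| mdiff f n x |) `^ q)%:E <= y%:E)%E.
Proof.
move=> H; apply: lime_le.
  by apply: is_cvg_nneseries => n _ _; rewrite lee_fin powR_ge0.
apply: nearW => N; rewrite sumEFin lee_fin; apply: le_trans (H N).
by rewrite /psum -(big_mkord xpredT (fun n => `|mdiff f n x| `^ q)).
Qed.

Lemma Sq_ge q f N x : 0 < q -> ((pSq q f N x)%:E <= Sq q f x)%E.
Proof.
move=> q0; rewrite /Sq /pSq -poweR_EFin.
have S := psum_le_series q f N x.
apply: gt0_ler_poweR => //; first by rewrite invr_ge0 ltW.
- by rewrite in_itv /= leey andbT lee_fin psum_ge0.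
- by rewrite in_itv /= leey andbT (le_trans _ S) // lee_fin psum_ge0.
Qed.

Lemma Sq_le q f x (y : R) : 0 < q -> 0 <= y -> (forall N, pSq q f N x <= y) ->
  (Sq q f x <= y%:E)%E.
Proof.
move=> q0 y0 H.
have S : (\sum_(0 <= n <oo) ((`| mdiff f n x |) `^ q)%:E <= (y `^ q)%:E)%E.
  apply: series_le => N; have := H N; rewrite -(ler_powR2r q0) ?powR_ge0 //.
  by rewrite /pSq powRVK // psum_ge0.
have S0 := le_trans _ (psum_le_series q f 0 x).
have -> : y%:E = poweR (y `^ q)%:E q^-1 by rewrite poweR_EFin powRKV.
rewrite /Sq; apply: gt0_ler_poweR => //; first by rewrite invr_ge0 ltW.
- by rewrite in_itv /= leey andbT S0 // lee_fin psum_ge0.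
- by rewrite in_itv /= leey andbT lee_fin powR_ge0.
Qed.

Lemma pSq_ge0 q f N x : 0 <= pSq q f N x.
Proof. exact: powR_ge0. Qed.

Lemma pSq_le q f n m x : 0 < q -> (n <= m)%N -> pSq q f n x <= pSq q f m x.
Proof.
move=> q0 nm; rewrite /pSq ler_powR2r ?invr_gt0 ?psum_ge0 //.
by apply: (ler_sum_ord (u := fun n => `|mdiff f n x| `^ q)) => // k; exact: powR_ge0.
Qed.

Lemma measurable_norm_mdiff f n : (forall n, strongly_measurable measurable (f n)) ->
  measurable_fun setT (fun x => `|mdiff f n x|).
Proof.
by move=> mf; case: n => [|n]; [exact: (measurable_norm (mf 0%N))|exact: (measurable_norm_sub (mf n.+1) (mf n))].
Qed.

Lemma measurable_norm_mdiff_powR q f n : (forall n, strongly_measurable measurable (f n)) ->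
  measurable_fun setT (fun x => `|mdiff f n x| `^ q).
Proof.
move=> mf; apply: (measurableT_comp (measurable_powR q)).
exact: measurable_norm_mdiff.
Qed.

Lemma measurable_pSq q f N : (forall n, strongly_measurable measurable (f n)) ->
  measurable_fun setT (pSq q f N).
Proof.
move=> mf; apply: (measurableT_comp (measurable_powR q^-1)).
by apply: measurable_sum => n; exact: measurable_norm_mdiff_powR.
Qed.

Lemma measurable_Sq q f : (forall n, strongly_measurable measurable (f n)) ->
  measurable_fun setT (Sq q f).
Proof.
move=> mf; apply: (measurableT_comp (measurable_poweR q^-1)).
apply: ge0_emeasurable_sum => n; first by move=> x _ _; rewrite lee_fin powR_ge0.
by move=> _; apply/measurable_EFinP; exact: measurable_norm_mdiff_powR.
Qed.

Lemma pSq_le_approx q f (b : nat -> B) N x : 1 <= q ->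
  pSq q f N.+1 x <= 2 * (\sum_(k < N) `|b k.+1 - b k| `^ q) `^ q^-1 +
    2 * (`|f 0 x| + 2 * \sum_(k < N.+1) `|f k x - b k|).
Proof.
move=> q1; have q0 : 0 < q by lra.
pose v n : R := if n is k.+1 then `|b k.+1 - b k| else 0.
pose e n : R := if n is k.+1 then `|f k.+1 x - b k.+1| + `|f k x - b k| else `|f 0 x|.
have v0 k : 0 <= v k by case: k => //= k.
have e0 k : 0 <= e k by case: k => //= k; rewrite addr_ge0.
have uve k : (k < N.+1)%N -> `|mdiff f k x| <= v k + e k.
  case: k => [|k] _ /=; first by rewrite add0r.
  have -> : f k.+1 x - f k x = (b k.+1 - b k) + ((f k.+1 x - b k.+1) - (f k x - b k)).
    by rewrite opprB [RHS]addrC addrAC !subrKA.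
  by apply: le_trans (ler_normD _ _) _; rewrite lerD2l ler_normB.
have := @lq_le_add _ q (fun k => `|mdiff f k x|) v e N.+1 q1 (fun k => normr_ge0 _) v0 e0 uve.
rewrite /pSq /psum => /le_trans; apply.
rewrite !(big_ord_recl N) /= powR0 ?gt_eqF // add0r lerD2l ler_wpM2l // lerD2l.
rewrite [X in X <= _](_ : _ = \sum_(k < N) `|f k.+1 x - b k.+1| + \sum_(k < N) `|f k x - b k|);
  last by rewrite big_split.
rewrite mulr2n mulrDl mul1r; apply: lerD.
  by rewrite lerDr.
rewrite -[leRHS](big_ord_recl N (fun k => `|f k x - b k|)).
exact: (ler_sum_ord (u := fun k => `|f k x - b k|)).
Qed.

End PartialSquareFunction.

(** * The four implications *)

Section Scaling.
Context {R : realType} {B : normedModType R} (Omega : finType).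
Implicit Types (w : Omega -> R) (X : nat -> Omega -> Omega).
Implicit Types (f : nat -> Omega -> B).

Lemma fmart_scale w X f (c : R) : fmart w X f ->
  fmart w X (fun n a => c *: f n a).
Proof.
move=> fm; split; [exact: fm_ge0 fm|exact: fm_refine fm| |].
  by move=> n a b /(fm_adapted fm) ->.
move=> n c0; rewrite -[RHS](scaler0 _ c) -[in RHS](fm_mean fm n c0) scaler_sumr.
by apply: eq_bigr => a _; rewrite -scalerBr !scalerA mulrC.
Qed.

Lemma fmart_scale_weight w X f (c : R) : 0 <= c -> fmart w X f ->
  fmart (fun a => c * w a) X f.
Proof.
move=> c0 fm; split; [|exact: fm_refine fm|exact: fm_adapted fm|].
  by move=> a; rewrite mulr_ge0 // (fm_ge0 fm).
move=> n d; rewrite -[RHS](scaler0 _ c) -[in RHS](fm_mean fm n d) scaler_sumr.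
by apply: eq_bigr => a _; rewrite scalerA.
Qed.

Lemma lqsum_scale q f (c : R) N a : 0 <= c ->
  lqsum q (fun n a => c *: f n a) N a = c `^ q * lqsum q f N a.
Proof.
move=> c0; rewrite mulr_sumr; apply: eq_bigr => k _.
by rewrite -scalerBr normrZ ger0_norm // powRM.
Qed.

Lemma fmart0 w X f : fmart w X f -> fmart w X (fun _ _ => 0 : B).
Proof.
move=> fm; split; [exact: fm_ge0 fm|exact: fm_refine fm|by []|].
by move=> n c; rewrite big1 // => a _; rewrite subrr scaler0.
Qed.

End Scaling.

Section CotypeImpliesTight.
Context {R : realType} {B : completeNormedModType R}.

Lemma cotype_bounded_fmart (q : R) : 1 <= q -> martingale_cotype B q ->
  exists p C : R, [/\ 0 < p, 0 < C &
  forall (Omega : finType) (w : Omega -> R) (X : nat -> Omega -> Omega)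
         (g : nat -> Omega -> B) (N : nat),
    fmart w X g -> (forall a, g 0%N a = 0) -> \sum_a w a = 1 ->
    (forall n a, `|g n a| <= 2) -> forall L : R, 0 < L ->
    L `^ (p / q) * \sum_(a | L <= lqsum q g N a) w a <= C].
Proof.
move=> q1 [p [p1 [C HC]]]; have q0 : 0 < q by lra.
have p0 : 0 < p by lra.
pose C' := `|C| + 1.
have C'0 : 0 < C' by rewrite ltr_wpDl.
exists p, ((C' * 2) `^ p); split => //; first by rewrite powR_gt0 // mulr_gt0.
move=> Om w X g N fm g0 w1 g2 L L0.
pose Omega := fun k : nat => Om.
(* [g] followed by blocks that stay at 0. *)
pose fk k : nat -> Omega k -> B := if k is k'.+1 then fun _ _ => 0 else g.
have fmk k : fmart w X (fk k) by case: k => [|k] //; exact: fmart0 fm.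
have fk0 k : forall a, fk k 0%N a = 0 by case: k.
have [d [T [P [om omP]]]] := @independent_sequence R Omega (fun _ => w) (fun _ => fm_ge0 fm) (fun _ => w1).
pose NN := fun k : nat => N.
pose cf := concat fk NN om.
have Mart := concat_martingale NN fmk fk0 omP.
have Filt := concat_filtrationP NN fmk omP.
have Msm n : strongly_measurable measurable (cf n).
  have [h _] := Mart; have [_ [h2 _]] := Filt.
  exact: strongly_measurable_sub (h2 n) (h n).
have hs2 k (a : history Omega k) : `|history_sum fk NN a| <= 2.
  elim: k a => [|k IH]; first by move=> a /=; rewrite normr0.
  case: k IH => [|k] IH [a b] /=; first by rewrite add0r.
  by rewrite addr0; exact: IH.
have cf2 n x : `|cf n x| <= 2.
  rewrite /cf /concat /stage /=; case: (position NN n) => -[|k] t /=.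
    by rewrite add0r.
  by rewrite addr0 (hs2 k.+1 (history_of om k x, om k x)).
have LpB2 n : (LpB P p (cf n) <= 2%:E)%E.
  rewrite /LpB unlock.
  have -> : 2%:E = poweR (2 `^ p)%:E p^-1 by rewrite poweR_EFin powRKV.
  have I : (\int[P]_x (`|(`|cf n x|)%:E| `^ p) <= (2 `^ p)%:E)%E.
    have -> : ((2 `^ p)%:E = \int[P]_x (2 `^ p)%:E :> \bar R)%E.
      by rewrite integral_cst // prE // prT mule1.
    apply: ge0_le_integral => //.
    - by move=> x _; exact: poweR_ge0.
    - under eq_fun do rewrite /= normr_id.
      apply/measurable_EFinP; apply: (measurableT_comp (measurable_powR p)).
      exact: (measurable_norm (Msm n)).
    - move=> x _; rewrite /= normr_id lee_fin.
      by rewrite ler_powR2r.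
  have I0 : (0 <= \int[P]_x (`|(`|cf n x|)%:E| `^ p))%E.
    by apply: integral_ge0 => x _; exact: poweR_ge0.
  apply: gt0_ler_poweR => //; first by rewrite invr_ge0 ltW.
  - by rewrite in_itv /= leey andbT.
  - by rewrite in_itv /= leey andbT lee_fin powR_ge0.
have SUP : (Lnorm P p%:E (Sq q cf) <= (C' * 2)%:E)%E.
  apply: le_trans (HC _ _ _ _ _ Filt Mart) _.
  set s := ereal_sup _.
  have s2 : (s <= 2%:E)%E by apply: ge_ereal_sup => _ [n _ <-]; exact: LpB2.
  have s0 : (0 <= s)%E.
    apply: (@le_trans _ _ (LpB P p (cf 0%N))); first exact: Lnorm_ge0.
    by apply: ereal_sup_ubound; exists 0%N.
  rewrite EFinM; apply: (@le_trans _ _ (C'%:E * s)%E).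
    by apply: lee_wpmul2r => //; rewrite lee_fin /C'; have := ler_norm C; lra.
  by apply: lee_wpmul2l => //; rewrite lee_fin ltW.
have [M HM] := concat_Sq_ge fk NN om q 1.
pose A := [set x | (fun i : history Omega 1 => L <= lqsum q g N i.2) (history_of om 1 x)].
have mh k a : measurable (history_of om k @^-1` [set a]) by have [] := omP k a.
have mA : measurable A.
  exact: (measurable_preim_fin (mh 1%N) [set i | L <= lqsum q g N i.2]).
have prA : pr P A = \sum_(a | L <= lqsum q g N a) w a.
  apply: etrans (pr_fin P (mh 1%N) (fun i : history Omega 1 => L <= lqsum q g N i.2)) _.
  rewrite (eq_bigr _ (fun i _ => proj2 (omP 1%N i))) big_mkcond /=.
  rewrite -(pair_bigA _ (fun (a : unit) b => if L <= lqsum q g N b then 1 * w b else 0)) /=.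
  rewrite (bigD1 tt) //= [X in _ + X]big1 => [|[]//].
  rewrite addr0 [RHS]big_mkcond; apply: eq_bigr => b _; by rewrite mul1r.
have low : ((L `^ (p / q) * pr P A)%:E <= (Lnorm P p%:E (Sq q cf)) `^ p)%E.
  rewrite poweR_Lnorm ?gt_eqF // EFinM -(prE P mA).
  rewrite -[X in ((_ * (_ : {measure set T -> \bar R}) X) <= _)%E]setIT.
  rewrite -integral_indic // -ge0_integralZl_EFin //; last 2 first.
  - by apply/measurable_EFinP; exact: measurable_indic.
  - exact: powR_ge0.
  have mS : measurable_fun setT (fun x => (`|Sq q cf x| `^ p)%E).
    apply: (measurableT_comp (measurable_poweR p)).
    by apply: measurableT_comp => //; exact: measurable_Sq.
  apply: ge0_le_integral => //.
  - by move=> x _; rewrite -EFinM lee_fin mulr_ge0 // powR_ge0.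
  - apply: measurable_funeM; apply/measurable_EFinP; exact: measurable_indic.
  move=> x _; rewrite indicE; case: (boolP (x \in A)) => [|_]; last first.
    by rewrite mule0 poweR_ge0.
  rewrite inE /A /= mule1 => LA.
  have H1 : ((L `^ q^-1)%:E <= `|Sq q cf x|)%E.
    rewrite gee0_abs ?poweR_ge0 //; apply: le_trans (Sq_ge cf M x q0).
    rewrite lee_fin /pSq ler_powR2r ?invr_gt0 ?psum_ge0 ?(ltW L0) //.
    by apply: (le_trans LA); have := HM x; rewrite big_ord_recl big_ord0 addr0.
  have -> : (L `^ (p / q))%:E = poweR (L `^ q^-1)%:E p.
    by rewrite poweR_EFin -powRrM mulrC.
  apply: gt0_ler_poweR => //; first exact: ltW.
  - by rewrite in_itv /= leey andbT lee_fin powR_ge0.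
  - by rewrite in_itv /= leey andbT.
rewrite -prA -lee_fin; apply: (le_trans low).
rewrite -poweR_EFin; apply: gt0_ler_poweR => //; first exact: ltW.
- by rewrite in_itv /= leey andbT; exact: Lnorm_ge0.
- by rewrite in_itv /= leey andbT lee_fin mulr_ge0 // ltW.
Qed.

Lemma cotype_tight (q : R) : 2 <= q -> martingale_cotype B q -> tight B q.
Proof.
move=> q2 Hc; have q1 : 1 <= q by lra. have q0 : 0 < q by lra.
have [p [C [p0 C0 HC]]] := cotype_bounded_fmart q1 Hc.
move=> e e0; pose L := (C / (e / 2)) `^ (q / p).
have Ce0 : 0 < C / (e / 2) by rewrite !divr_gt0.
have L0 : 0 < L by exact: powR_gt0.
have LE : L `^ (p / q) = C / (e / 2).
  rewrite /L -powRrM; have -> : q / p * (p / q) = 1 by field; rewrite !gt_eqF.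
  by rewrite powRr1 // ltW.
pose c := (2 `^ q * (L + 1)) `^ q^-1.
have cq : c `^ q = 2 `^ q * (L + 1).
  by rewrite powRVK // mulr_ge0 ?powR_ge0 //; lra.
have c0 : 0 < c by rewrite powR_gt0 // mulr_gt0 ?powR_gt0 //; lra.
exists (e / (6 * c)); first by rewrite divr_gt0 // mulr_gt0.
move=> Om w X f N fm f0; set W := \sum_a w a => Hf.
have w0 := fm_ge0 fm.
have [W0|Wn0] := eqVneq W 0.
  rewrite W0 mulr0; apply: (@le_trans _ _ W); last by rewrite W0.
  rewrite /W [leLHS]big_mkcond; apply: ler_sum => a _.
  by case: ifP.
have Wp : 0 < W by rewrite lt_neqAle eq_sym Wn0 sumr_ge0.
pose F n a := c *: f n a.
have fmF : fmart w X F by exact: fmart_scale.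
have F0 a : F 0%N a = 0 by rewrite /F f0 scaler0.
pose g := gundy w X F N.
have fmg : fmart w X g by exact: gundy_fmart.
have fmg' : fmart (fun a => W^-1 * w a) X g.
  by apply: fmart_scale_weight; rewrite ?invr_ge0 1?ltW.
have w1 : \sum_a W^-1 * w a = 1 by rewrite -mulr_sumr mulVf.
have := HC _ _ _ g N fmg' (gundy0 w X F N) w1 (gundy_bounded fmF F0 N) L L0.
rewrite LE -mulr_sumr => HG.
have {}HG : \sum_(a | L <= lqsum q g N a) w a <= e / 2 * W.
  move: HG; set S := \sum_(_ | _) _ => HG.
  have : C / (e / 2) * (W^-1 * S) = C * (S / (e / 2 * W)).
    by field; rewrite !gt_eqF.
  by move=> E; move: HG; rewrite E ger_pMr // ler_pdivrMr ?mul1r // mulr_gt0 // divr_gt0.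
have HB := gundy_bad_le fmF F0 N.
have {}HB : \sum_(a | gundy_bad w X F N a) w a <= e / 2 * W.
  apply: (le_trans HB).
  have -> : \sum_a w a * `|F N a| = c * \sum_a w a * `|f N a|.
    by rewrite mulr_sumr; apply: eq_bigr => a _; rewrite normrZ gtr0_norm // mulrCA.
  rewrite mulrA; apply: (le_trans (ler_wpM2l _ Hf)); first by rewrite mulr_ge0 // ltW.
  rewrite le_eqVlt; apply/orP; left; apply/eqP; field; rewrite gt_eqF //.
have -> : e * W = e / 2 * W + e / 2 * W by rewrite -mulrDl -splitr.
apply: le_trans (lerD HB HG).
rewrite [leLHS]big_mkcond [X in _ <= X + _]big_mkcond [X in _ <= _ + X]big_mkcond /=.
rewrite -big_split /=; apply: ler_sum => a _.
have [bad|good] := boolP (gundy_bad w X F N a).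
  by case: ifP => _; case: ifP => _; rewrite ?lerDl ?addr0 ?addr_ge0.
rewrite add0r; case: ifPn => [f1|_]; last by case: ifP.
rewrite ifT //; have := gundy_good fmF q1 good.
rewrite lqsum_scale ?(ltW c0) // cq -/g -mulrA ler_pM2l ?powR_gt0 //.
have : (L + 1) * 1 <= (L + 1) * lqsum q f N a by rewrite ler_wpM2l //; lra.
lra.
Qed.

End CotypeImpliesTight.

Section ConvergenceImpliesTight.
Context {R : realType} {B : completeNormedModType R}.

Record block := Block {
  bspace : finType;
  bweight : bspace -> R;
  binfo : nat -> bspace -> bspace;
  bproc : nat -> bspace -> B;
  blength : nat }.

Definition bhit (q : R) (b : block) (a : bspace b) : bool :=
  1 <= lqsum q (bproc (b := b)) (blength b) a.

Lemma not_tight_blocks (q e : R) : 0 < e ->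
  ~ (exists2 k : R, 0 < k &
  forall (Omega : finType) (w : Omega -> R) (X : nat -> Omega -> Omega)
         (f : nat -> Omega -> B) (N : nat),
    fmart w X f -> (forall a, f 0%N a = 0) ->
    \sum_a w a * `|f N a| <= k * \sum_a w a ->
    \sum_(a | 1 <= lqsum q f N a) w a <= e * \sum_a w a) ->
  forall k : R, 0 < k -> exists b : block,
    [/\ fmart (bweight (b := b)) (binfo (b := b)) (bproc (b := b)),
        forall a : bspace b, bproc 0 a = 0, \sum_(a : bspace b) bweight a = 1,
        \sum_(a : bspace b) bweight a * `|bproc (blength b) a| <= k &
        e <= \sum_(a : bspace b | bhit q a) bweight a].
Proof.
move=> e0 nk k k0; apply: contrapT => nb; apply: nk; exists k => //.
move=> Om w X f N fm f0 Hf; rewrite leNgt; apply/negP => bad; apply: nb.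
have w0 := fm_ge0 fm.
set W := \sum_a w a in Hf bad.
have W0 : 0 <= W by exact: sumr_ge0.
have hW : \sum_(a | 1 <= lqsum q f N a) w a <= W.
  by rewrite /W [leLHS]big_mkcond; apply: ler_sum => a _; case: ifP.
have Wp : 0 < W.
  rewrite lt_neqAle W0 andbT eq_sym; apply/eqP => WE.
  by have := lt_le_trans bad hW; rewrite WE mulr0 ltxx.
exists (Block (fun a => W^-1 * w a) X f N); split => //=.
- by apply: fmart_scale_weight => //; rewrite invr_ge0.
- by rewrite -mulr_sumr mulVf // gt_eqF.
- under eq_bigr do rewrite -mulrA.
  by rewrite -mulr_sumr mulrC ler_pdivrMr.
- rewrite -mulr_sumr mulrC ler_pdivlMr //; exact: ltW.
Qed.

Lemma convergence_tight (q : R) : 0 < q ->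
  (forall (d : measure_display) (T : measurableType d)
          (P : probability T R) (F : nat -> set (set T))
          (f : nat -> T -> B),
     filtration F -> martingale P F f ->
     (ereal_sup (range (fun n => LpB P 1 (f n))) < +oo)%E ->
     {ae P, forall x, (Sq q f x < +oo)%E}) -> tight B q.
Proof.
move=> q0 H e e0; apply: contrapT => nk.
have k0 (j : nat) : 0 < (1 / 2 : R) ^+ j by rewrite exprn_gt0.
have /choice[b bP] := fun j => not_tight_blocks e0 nk (k0 j).
pose Omega j := bspace (b j).
pose p j : Omega j -> R := bweight (b := b j).
pose X j : nat -> Omega j -> Omega j := binfo (b := b j).
pose f j : nat -> Omega j -> B := bproc (b := b j).
pose N j := blength (b j).
pose E j : pred (Omega j) := bhit q (b := b j).
have fm j : fmart (p j) (X j) (f j) by have [] := bP j.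
have f0 j a : f j 0%N a = 0 by have [_ + _ _ _] := bP j; exact.
have p1 j : \sum_a p j a = 1 by have [] := bP j.
have small j : \sum_a p j a * `|f j (N j) a| <= (1 / 2) ^+ j by have [] := bP j.
have big j : e <= \sum_(a | E j a) p j a by have [] := bP j.
have p0 j a : 0 <= p j a by exact: (fm_ge0 (fm j)).
have e1 : e <= 1.
  apply: le_trans (big 0%N) _; rewrite -(p1 0%N) [leLHS]big_mkcond.
  by apply: ler_sum => a _; case: ifP.
have [d [T [P [om omP]]]] := independent_sequence p0 p1.
pose cf := concat f N om.
have Mart := concat_martingale N fm f0 omP.
have Filt := concat_filtrationP N fm omP.
have mh k a : measurable (history_of om k @^-1` [set a]) by have [] := omP k a.
have geo n : \sum_(j < n) (1 / 2 : R) ^+ j <= 2.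
  have -> : \sum_(j < n) (1 / 2 : R) ^+ j = 2 - 2 * (1 / 2) ^+ n.
    elim: n => [|n IH]; first by rewrite big_ord0 expr0; lra.
    by rewrite big_ord_recr /= IH exprS; lra.
  by rewrite gerBl mulr_ge0 // ltW.
have L1 n : (LpB P 1 (cf n) <= 2%:E)%E.
  rewrite /LpB Lnorm1; under eq_integral do rewrite /= normr_id.
  apply: le_trans (concat_norm_le N fm p1 omP n) _; rewrite lee_fin.
  by apply: le_trans (geo (position N n).1.+1); apply: ler_sum.
have /H : (ereal_sup (range (fun n => LpB P 1 (cf n))) < +oo)%E.
  apply: le_lt_trans (ltry 2); apply: ge_ereal_sup => _ [n _ <-]; exact: L1.
move=> /(_ _ Filt Mart) HS.
pose G m := [set x | forall j, (m <= j)%N -> ~~ E j (om j x)].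
have cover : [set: T] `<=` ~` [set x | (Sq q cf x < +oo)%E] `|` \bigcup_m G m.
  move=> x _; have [Sx|Sx] := pselect (Sq q cf x < +oo)%E; last by left.
  right; apply: contrapT => nG.
  have inf m : exists2 j, (m <= j)%N & E j (om j x).
    apply: contrapT => nj; apply: nG; exists m => // j mj; apply/negP => Ej.
    by apply: nj; exists j.
  have unb n : exists J, n%:R <= \sum_(j < J) lqsum q (f j) (N j) (om j x).
    elim: n => [|n [J HJ]]; first by exists 0%N; rewrite big_ord0.
    have [j Jj Ej] := inf J; exists j.+1; rewrite big_ord_recr /= -natr1.
    apply: lerD => //; apply: le_trans HJ _.
    have l0 i : 0 <= lqsum q (f i) (N i) (om i x) by exact: lqsum_ge0.
    exact: (ler_sum_ord (u := fun i => lqsum q (f i) (N i) (om i x))).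
  have [J] := unb (Num.truncn (fine (Sq q cf x) `^ q)).+1.
  have [M /(_ x) HM] := concat_Sq_ge f N om q J.
  move=> /le_trans /(_ HM); rewrite leNgt => /negP; apply.
  have Sfin : Sq q cf x \is a fin_num by rewrite ge0_fin_numE ?poweR_ge0.
  apply: le_lt_trans (truncnS_gt _).
  have := Sq_ge cf M x q0; rewrite -(fineK Sfin) lee_fin.
  rewrite -(ler_powR2r q0) ?pSq_ge0 ?fine_ge0 ?poweR_ge0 //.
  by rewrite /pSq powRVK // psum_ge0.
(* No block with index in [m, k[ has variation at least 1. *)
pose avoid m := fix avoid k : history Omega k -> bool :=
  if k is k'.+1 then fun a => avoid k' a.1 && ((m <= k')%N ==> ~~ E k' a.2)
  else fun=> true.
have avoid_weight m k : \sum_(a | avoid m k a) history_weight p a <= (1 - e) ^+ (k - m).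
  elim: k => [|k IH].
    rewrite sub0n expr0 (_ : \sum_(_ | _) _ = \sum_(a : history Omega 0) history_weight p a) //.
    by rewrite history_weight_sum.
  have -> : \sum_(a | avoid m k.+1 a) history_weight p a =
     (\sum_(a | avoid m k a) history_weight p a) *
       \sum_(c | (m <= k)%N ==> ~~ E k c) p k c.
    rewrite mulr_suml.
    under [RHS]eq_bigr do rewrite mulr_sumr.
    by rewrite pair_big.
  have [mk|km] := leqP m k.
    rewrite subSn // exprSr; apply: ler_pM => //=.
    - by apply: sumr_ge0 => a _; exact: history_weight_ge0.
    - exact: sumr_ge0.
    rewrite -(p1 k) [X in _ <= X - _](bigID (E k)) /=.
    by have := big k; lra.
  rewrite (eqP (_ : k.+1 - m == 0)%N) ?subn_eq0 // expr0 -[leRHS]mulr1.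
  apply: ler_pM => //=.
  - by apply: sumr_ge0 => a _; exact: history_weight_ge0.
  - exact: sumr_ge0.
  - by apply: (le_trans IH); rewrite (eqP (_ : k - m == 0)%N) ?subn_eq0 // ltnW.
  - by rewrite p1.
have avoidP m k x : G m x -> avoid m k (history_of om k x).
  move=> Gx; elim: k => [|k IH] //=; rewrite IH /=.
  by apply/implyP => mk; exact: Gx.
have G0 m : P.-negligible (G m).
  exists (\bigcap_k (history_of om k @^-1` [set a | avoid m k a])); split.
  - by apply: bigcap_measurableType => k _; apply: measurable_preim_fin; exact: mh.
  - set A := \bigcap_k _.
    have mA : measurable A.
      by apply: bigcap_measurableType => k _; apply: measurable_preim_fin; exact: mh.
    rewrite prE //; congr (_%:E); apply/eqP; rewrite eq_le pr_ge0 andbT.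
    have Ak s : pr P A <= (1 - e) ^+ s.
      apply: le_trans (_ : pr P (history_of om (m + s)%N @^-1` [set a | avoid m (m + s)%N a]) <= _).
        apply: pr_le => //; first by apply: measurable_preim_fin; exact: mh.
        by move=> x; apply.
      have -> : pr P (history_of om (m + s)%N @^-1` [set a | avoid m (m + s)%N a]) =
          \sum_(a | avoid m (m + s)%N a) history_weight p a.
        apply: etrans (pr_fin P (mh (m + s)%N) (avoid m (m + s)%N)) _.
        by apply: eq_bigr => a _; have [] := omP (m + s)%N a.
      by have := avoid_weight m (m + s)%N; rewrite addKn.
    have c0 : (1 - e) ^+ s @[s --> \oo] --> (0 : R).
      by apply: cvg_expr; rewrite ger0_norm; lra.
    by apply: (cvgr_to_ge c0); exact: nearW.
  - by move=> x Gx k _; exact: avoidP.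
have : P.-negligible [set: T].
  apply: negligibleS cover _; apply: negligibleU; first exact: HS.
  exact: negligible_bigcup.
move=> /(measure_negligible measurableT) /(congr1 fine).
by rewrite -/(pr P _) prT => /eqP; rewrite oner_eq0.
Qed.

End ConvergenceImpliesTight.

Section TightImplies.
Context {R : realType} {B : completeNormedModType R}.

Lemma fmart_sub0 (Omega : finType) (w : Omega -> R) X (g : nat -> Omega -> B) :
  fmart w X g -> fmart w X (fun n a => g n a - g 0%N a).
Proof.
move=> fm; split; [exact: fm_ge0 fm|exact: fm_refine fm| |].
  by move=> n a b Xab; rewrite (fm_adapted fm Xab) (fm_adapted_le fm (leq0n n) Xab).
move=> n c; rewrite -[RHS](fm_mean fm n c); apply: eq_bigr => a _.
by rewrite opprB subrKA.
Qed.

Lemma measurable_level_ge {d} {T : measurableType d} (u : T -> R) (L : R) :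
  measurable_fun setT u -> measurable [set x | L <= u x].
Proof.
move=> mu; rewrite -[X in measurable X]setTI.
exact: (@measurable_fun_le _ _ _ _ (cst L)).
Qed.

Lemma measurable_level_gt {d} {T : measurableType d} (u : T -> R) (L : R) :
  measurable_fun setT u -> measurable [set x | L < u x].
Proof.
move=> mu; rewrite (_ : [set x | L < u x] = ~` [set x | u x <= L]).
  apply: measurableC; rewrite -[X in measurable X]setTI.
  exact: (@measurable_fun_le _ _ _ _ u (cst L)).
by apply/seteqP; split => x /=; rewrite ltNge => /negP.
Qed.

Lemma markov_pr {d} {T : measurableType d} (P : probability T R) (u : T -> R) (L : R) :
  measurable_fun setT u -> (forall x, 0 <= u x) -> 0 < L ->
  ((L * pr P [set x | (L <= u x)%R])%:E <= \int[P]_x (u x)%:E)%E.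
Proof.
move=> mu u0 L0; set A := [set x | _].
have mA : measurable A by exact: measurable_level_ge.
rewrite EFinM -(prE P mA).
rewrite -[X in ((_ * (_ : {measure set T -> \bar R}) X) <= _)%E]setIT.
rewrite -integral_indic // -ge0_integralZl_EFin //; last 2 first.
- by apply/measurable_EFinP; exact: measurable_indic.
- exact: ltW.
apply: ge0_le_integral => //.
- by move=> x _; rewrite -EFinM lee_fin mulr_ge0 // ltW.
- apply: measurable_funeM; apply/measurable_EFinP; exact: measurable_indic.
- exact/measurable_EFinP.
move=> x _; rewrite -EFinM lee_fin indicE; case: (boolP (x \in A)) => [|_].
  by rewrite inE mulr1.
by rewrite mulr0.
Qed.

Context {d : measure_display} {T : measurableType d} (P : probability T R).

Lemma integral_sum_norm (u : nat -> T -> R) n : (forall k, measurable_fun setT (u k)) ->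
  (forall k x, 0 <= u k x) ->
  (\int[P]_x (\sum_(k < n) u k x)%:E = \sum_(k < n) \int[P]_x (u k x)%:E)%E.
Proof.
move=> mu u0; under eq_integral do rewrite -sumEFin.
rewrite ge0_integral_sum //.
- by move=> k; exact/measurable_EFinP.
- by move=> k x _; rewrite lee_fin.
Qed.

Lemma tight_convergence (q : R) (F : nat -> set (set T)) (f : nat -> T -> B) :
  1 <= q -> tight B q -> filtration F -> martingale P F f ->
  (ereal_sup (range (fun n => LpB P 1 (f n))) < +oo)%E ->
  {ae P, forall x, (Sq q f x < +oo)%E}.
Proof.
move=> q1 Ht Ff Mf Hsup; have q0 : 0 < q by lra.
have [_ [Fm _]] := Ff; have [Ms _] := Mf.
have mf n : strongly_measurable measurable (f n).
  exact: strongly_measurable_sub (Fm n) (Ms n).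
have [M [M0 HM]] : exists M : R, 0 <= M /\ forall n, (\int[P]_x (`|f n x|)%:E <= M%:E)%E.
  set s := ereal_sup _ in Hsup.
  have fs n : (\int[P]_x (`|f n x|)%:E <= s)%E.
    have -> : (\int[P]_x (`|f n x|)%:E = LpB P 1 (f n))%E.
      by rewrite /LpB Lnorm1; apply: eq_integral => x _; rewrite /= normr_id.
    by apply: ereal_sup_ubound; exists n.
  have s0 : (0 <= s)%E.
    by apply: le_trans (fs 0%N); apply: integral_ge0 => x _; rewrite lee_fin.
  exists (fine s); split; first exact: fine_ge0.
  by move=> n; rewrite fineK // ge0_fin_numE.
have msp N : measurable_fun setT (pSq q f N) by exact: measurable_pSq.
have bound e : 0 < e -> exists L : R, forall N,
    pr P [set x | (L < pSq q f N.+1 x)%R] <= 2 * e.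
  move=> e0; have [k k0 Hk] := Ht e e0.
  pose c := k / (2 * (M + 1)).
  have c0 : 0 < c by rewrite divr_gt0 //; lra.
  pose L := (M + 2) / e.
  have L0 : 0 < L by rewrite divr_gt0 //; lra.
  exists (2 / c + 2 * L) => N.
  have eta0 : 0 < N.+1%:R^-1 :> R by rewrite invr_gt0.
  have [Om [H [X [g [mH fmg gclose _]]]]] := martingale_approx N Ff Mf eta0.
  pose w i := pr P (H @^-1` [set i]).
  have w1 : \sum_i w i = 1.
    rewrite -(prT P) (pr_finI P mH measurableT); apply: eq_bigr => i _.
    by rewrite setIT.
  pose G n a := c *: (g n a - g 0%N a).
  have fmG : fmart w X G by apply: fmart_scale; exact: fmart_sub0.
  have G0 a : G 0%N a = 0 by rewrite /G subrr scaler0.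
  have mgH n : strongly_measurable measurable (g n \o H) by exact: strongly_measurable_fin.
  have gL1 n : (n <= N)%N -> \sum_i w i * `|g n i| <= M + 1.
    move=> nN; rewrite -lee_fin -(expectation_fin P mH (g := fun i => `|g n i|)) //.
    have := integral_norm_triangle P measurableT (mgH n) strongly_measurable0 (mf n).
    under eq_integral do rewrite subr0.
    move=> /le_trans; apply; rewrite EFinD addeC; apply: leeD.
      by under eq_integral do rewrite subr0; exact: HM.
    under eq_integral do rewrite distrC.
    apply: le_trans (gclose n nN) _; rewrite lee_fin invf_le1 // ler1n //.
  have HG : \sum_a w a * `|G N a| <= k * \sum_a w a.
    rewrite w1 mulr1.
    apply: (@le_trans _ _ (c * (\sum_a w a * `|g N a| + \sum_a w a * `|g 0%N a|))).
      rewrite -big_split mulr_sumr; apply: ler_sum => a _ /=.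
      rewrite normrZ gtr0_norm // mulrCA -mulrDr ler_wpM2l ?(ltW c0) //.
      by rewrite ler_wpM2l ?pr_ge0 // ler_normB.
    apply: (@le_trans _ _ (c * (2 * (M + 1)))).
      rewrite ler_wpM2l ?(ltW c0) //.
      by have := gL1 _ (leqnn N); have := gL1 _ (leq0n N); lra.
    by rewrite /c mulfVK // gt_eqF //; lra.
  have := Hk Om w X G N fmG G0 HG; rewrite w1 mulr1 => H1.
  pose D x := `|f 0%N x| + 2 * \sum_(j < N.+1) `|f j x - g j (H x)|.
  have D0 x : 0 <= D x by rewrite addr_ge0 // mulr_ge0 // sumr_ge0.
  have mE : measurable_fun setT (fun x => \sum_(j < N.+1) `|f j x - g j (H x)|).
    by apply: measurable_sum => j; exact: measurable_norm_sub (mf j) (mgH j).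
  have mD : measurable_fun setT D.
    apply: measurable_funD; first exact: (measurable_norm (mf 0%N)).
    by apply: measurable_funM => //; exact: measurable_cst.
  have ID : (\int[P]_x (D x)%:E <= (M + 2)%:E)%E.
    rewrite /D; under eq_integral do rewrite EFinD EFinM.
    have mE' : measurable_fun setT (fun x => (\sum_(j < N.+1) `|f j x - g j (H x)|)%:E).
      exact/measurable_EFinP.
    rewrite ge0_integralD //; last 3 first.
    - by apply/measurable_EFinP; exact: (measurable_norm (mf 0%N)).
    - by move=> x _; rewrite -EFinM lee_fin mulr_ge0 // sumr_ge0.
    - exact: measurable_funeM.
    rewrite ge0_integralZl_EFin //; last by move=> x _; rewrite lee_fin sumr_ge0.
    rewrite [leRHS]EFinD; apply: leeD; first exact: HM.
    rewrite (integral_sum_norm (u := fun j x => `|f j x - g j (H x)|)) //; last first.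
      by move=> j; exact: measurable_norm_sub (mf j) (mgH j).
    rewrite -[leRHS]mule1; apply: lee_wpmul2l => //.
    apply: (@le_trans _ _ (\sum_(j < N.+1) (N.+1%:R^-1)%:E)%E).
      by apply: lee_sum => j _; apply: gclose; rewrite -ltnS.
    by rewrite sumEFin sumr_const card_ord -[_ *+ _]mulr_natr mulVf // pnatr_eq0.
  have H2 : pr P [set x | (L <= D x)%R] <= e.
    have := le_trans (markov_pr P mD D0 L0) ID; rewrite lee_fin /L.
    by rewrite -ler_pdivlMl // invf_div divfK // gt_eqF //; lra.
  have mA : measurable [set x | (1 <= lqsum q G N (H x))%R].
    exact: (measurable_preim_fin mH [set a | 1 <= lqsum q G N a]).
  have mB : measurable [set x | (L <= D x)%R] by exact: measurable_level_ge.
  have mC : measurable [set x | (2 / c + 2 * L < pSq q f N.+1 x)%R].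
    exact: measurable_level_gt.
  have sub : [set x | (2 / c + 2 * L < pSq q f N.+1 x)%R] `<=`
      [set x | (1 <= lqsum q G N (H x))%R] `|` [set x | (L <= D x)%R].
    move=> x /= hx; have [LD|DL] := leP L (D x); [by right|left].
    have := lt_le_trans hx (pSq_le_approx f (fun n => g n (H x)) N x q1).
    rewrite -/(D x) /G lqsum_scale ?(ltW c0) //.
    set s := \sum_(k < N) _ => h.
    have sE : lqsum q (fun n a => g n a - g 0%N a) N (H x) = s.
      by apply: eq_bigr => j _; rewrite opprB subrKA.
    have s0 : 0 <= s by apply: sumr_ge0 => j _; exact: powR_ge0.
    rewrite sE; have h2 : c^-1 < s `^ q^-1 by move: h; lra.
    have cs0 : 0 <= c * s `^ q^-1 by rewrite mulr_ge0 ?powR_ge0 ?(ltW c0).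
    rewrite -(powRVK q0 s0) -powRM ?powR_ge0 ?(ltW c0) //.
    have -> : 1 = 1 `^ q :> R by rewrite powR1.
    by rewrite ler_powR2r // -ler_pdivrMl // mulr1 ltW.
  apply: (le_trans (pr_le P mC (measurableU _ _ mA mB) sub)).
  apply: (@le_trans _ _ (pr P [set x | (1 <= lqsum q G N (H x))%R] + pr P [set x | (L <= D x)%R])).
    rewrite -lee_fin EFinD -!prE //; last exact: measurableU.
    exact: measureU2.
  rewrite [X in X + _ <= _](pr_fin P mH (fun a => 1 <= lqsum q G N a)).
  by move: H1 H2; rewrite -/w; lra.
have mS : measurable [set x | (Sq q f x = +oo)%E].
  have -> : [set x | (Sq q f x = +oo)%E] = setT `&` Sq q f @^-1` [set +oo%E].
    by rewrite setTI.
  exact: (measurable_Sq q mf).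
exists [set x | (Sq q f x = +oo)%E]; split => //; last first.
  by move=> x /=; rewrite ltey => /negP; rewrite negbK => /eqP.
rewrite prE //; congr (_%:E); apply/eqP; rewrite eq_le pr_ge0 andbT.
apply/ler_addgt0Pl => e e0; rewrite addr0.
have e20 : 0 < e / 2 by rewrite divr_gt0.
have [L HL] := bound _ e20.
pose A N := [set x | (L < pSq q f N.+1 x)%R].
have mA N : measurable (A N) by exact: measurable_level_gt.
have ndA : nondecreasing_seq A.
  move=> n m nm; apply/subsetPset => x /= /lt_le_trans; apply.
  exact: pSq_le.
have cA := nondecreasing_cvg_mu (mu := P) mA (bigcupT_measurable _ mA) ndA.
have sub : [set x | (Sq q f x = +oo)%E] `<=` \bigcup_N A N.
  move=> x /= Sx; apply: contrapT => nA.
  suff : (Sq q f x <= (Num.max 0 L)%:E)%E by rewrite Sx leNgt ltry.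
  have m0 : 0 <= Num.max 0 L by rewrite le_max lexx.
  apply: Sq_le => // N; rewrite le_max; apply/orP; right.
  apply: (@le_trans _ _ (pSq q f N.+1 x)); first exact: pSq_le.
  by rewrite leNgt; apply/negP => LN; apply: nA; exists N.
apply: (le_trans (pr_le P mS (bigcupT_measurable _ mA) sub)).
rewrite -lee_fin -prE //; last exact: bigcupT_measurable.
apply: (cvge_to_le cA); apply: nearW => N /=; rewrite prE // lee_fin.
by have := HL N; rewrite mulrC divfK.
Qed.

End TightImplies.

Section TightImpliesCotype.
Context {R : realType} {B : completeNormedModType R}.

Lemma fmart_sub0_L2 (Omega : finType) (w : Omega -> R) X (g : nat -> Omega -> B) N :
  fmart w X g -> \sum_a w a * `|g N a - g 0%N a| ^+ 2 <=
    130 * \sum_a w a * `|g N a| ^+ 2.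
Proof.
move=> fm; have w0 := fm_ge0 fm.
have D := doob_L2 N fm.
apply: (@le_trans _ _ (2 * \sum_a w a * `|g N a| ^+ 2 + 2 * \sum_a w a * maxnorm g N a ^+ 2)).
  rewrite !mulr_sumr -big_split; apply: ler_sum => a _ /=.
  rewrite ![2 * (w a * _)]mulrCA -mulrDr ler_wpM2l //.
  have h0 := le_maxnorm g a (leq0n N).
  apply: (@le_trans _ _ ((`|g N a| + maxnorm g N a) ^+ 2)).
    rewrite ler_sqr ?nnegrE ?addr_ge0 ?maxnorm_ge0 //.
    by apply: le_trans (ler_normB _ _) _; rewrite lerD2l.
  have := sqr_ge0 (`|g N a| - maxnorm g N a).
  by rewrite sqrrB sqrrD; set m := maxnorm _ _ _; set n := `|_|; lra.
by move: D; set u := \sum_a _; set v := \sum_a _; lra.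
Qed.

Context {d : measure_display} {T : measurableType d} (P : probability T R).

Lemma LpB2_le (u : T -> B) (M : R) : 0 <= M -> (LpB P 2 u <= M%:E)%E ->
  (\int[P]_x (`|u x| ^+ 2)%:E <= (M ^+ 2)%:E)%E.
Proof.
move=> M0 uM; have two0 : (2 : R) != 0 by rewrite pnatr_eq0.
have -> : (\int[P]_x (`|u x| ^+ 2)%:E = (LpB P 2 u) `^ 2)%E.
  rewrite /LpB poweR_Lnorm //; apply: eq_integral => x _.
  by rewrite /= normr_id powR_mulrn.
have -> : (M ^+ 2)%:E = poweR M%:E 2 by rewrite poweR_EFin powR_mulrn.
apply: gt0_ler_poweR => //.
- by rewrite in_itv /= leey andbT; exact: Lnorm_ge0.
- by rewrite in_itv /= leey andbT lee_fin.
Qed.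

Variables (q C0 : R).
Hypothesis q2 : 2 <= q.
Hypothesis C0_gt0 : 0 < C0.
Hypothesis HC0 : forall (Omega : finType) (w : Omega -> R) (X : nat -> Omega -> Omega)
         (f : nat -> Omega -> B) (N : nat),
    fmart w X f -> (forall a, f 0%N a = 0) ->
    \sum_a w a * lqnorm q f N a ^+ 2 <= C0 * \sum_a w a * `|f N a| ^+ 2.

Let q1 : 1 <= q. Proof. by apply: le_trans q2; rewrite ler1n. Qed.
Let q0 : 0 < q. Proof. by apply: lt_le_trans q2; rewrite ltr0n. Qed.

Lemma truncated_L2_bound F (f : nat -> T -> B) (M : R) N :
  filtration F -> martingale P F f ->
  (forall n, (\int[P]_x (`|f n x| ^+ 2)%:E <= (M ^+ 2)%:E)%E) ->
  (\int[P]_x (Num.min (pSq q f N.+1 x) N%:R ^+ 2)%:E <=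
    ((1040 * C0 + 8) * M ^+ 2)%:E)%E.
Proof.
move=> Ff Mf fM; have [_ [Fm _]] := Ff; have [Ms _] := Mf.
have mf n : strongly_measurable measurable (f n).
  exact: strongly_measurable_sub (Fm n) (Ms n).
apply/lee_addgt0Pr => e e0.
pose eta := e / (8 * (N.+1%:R * N.+1%:R)).
have NN0 : 0 < N.+1%:R :> R by rewrite ltr0n.
have eta0 : 0 < eta by rewrite divr_gt0 // !mulr_gt0.
have [Om [H [X [g [mH fmg gclose gL2]]]]] := martingale_approx N Ff Mf eta0.
pose w i := pr P (H @^-1` [set i]).
pose G n a := g n a - g 0%N a.
have fmG : fmart w X G by exact: fmart_sub0.
have G0 a : G 0%N a = 0 by rewrite /G subrr.
have mgH n : strongly_measurable measurable (g n \o H) by exact: strongly_measurable_fin.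
pose Err x := \sum_(j < N.+1) `|f j x - g j (H x)|.
have Err0 x : 0 <= Err x by exact: sumr_ge0.
have mErr : measurable_fun setT Err.
  by apply: measurable_sum => j; exact: measurable_norm_sub (mf j) (mgH j).
have point x : Num.min (pSq q f N.+1 x) N%:R ^+ 2 <=
    8 * lqnorm q G N (H x) ^+ 2 + (8 * `|f 0%N x| ^+ 2 + 8 * N%:R * Err x).
  have := pSq_le_approx f (fun n => g n (H x)) N x q1; rewrite -/(Err x).
  have -> : (\sum_(k < N) `|g k.+1 (H x) - g k (H x)| `^ q) `^ q^-1 = lqnorm q G N (H x).
    by congr (_ `^ _); apply: eq_bigr => j _; rewrite /G opprB subrKA.
  set m := Num.min _ _; set u := lqnorm _ _ _ _; set v := `|_| => hp.
  have m1 : m <= pSq q f N.+1 x by rewrite /m ge_min lexx.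
  have m2 : m <= N%:R by rewrite /m ge_min lexx orbT.
  have m0 : 0 <= m by rewrite /m le_min pSq_ge0 ler0n.
  have h1 : m * m <= m * (2 * u + 2 * (v + 2 * Err x)).
    by rewrite ler_wpM2l // (le_trans m1).
  have h2 : m * Err x <= N%:R * Err x by rewrite ler_wpM2r.
  have h3 := sqr_ge0 (m - 2 * (u + v)).
  have h4 := sqr_ge0 (u - v).
  move: h3 h4; rewrite !expr2 => h3 h4.
  rewrite -mulrA; move: h1 h2 h3 h4; set Z := N%:R * Err x; nra.
have w0 := fm_ge0 fmG.
have bG : 8 * \sum_i w i * lqnorm q G N i ^+ 2 <= 1040 * C0 * M ^+ 2.
  have h1 := HC0 N fmG G0; have h2 := fmart_sub0_L2 N fmg.
  have h3 : \sum_i w i * `|g N i| ^+ 2 <= M ^+ 2.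
    by rewrite -lee_fin; apply: le_trans gL2 _; exact: fM.
  have h4 : C0 * \sum_a w a * `|G N a| ^+ 2 <= C0 * (130 * M ^+ 2).
    by rewrite ler_wpM2l ?(ltW C0_gt0) //; move: h2; rewrite -/w /G; lra.
  by move: h1 h4; set u := \sum_i _; set v := C0 * \sum_a _; lra.
have mp : measurable_fun setT (pSq q f N.+1) by exact: measurable_pSq.
have mG : measurable_fun setT (fun x => (8 * lqnorm q G N (H x) ^+ 2)%:E).
  apply/measurable_EFinP.
  exact: (measurable_fun_fin mH (fun i => 8 * lqnorm q G N i ^+ 2)).
have mf0 : measurable_fun setT (fun x => (8 * `|f 0%N x| ^+ 2)%:E).
  apply/measurable_EFinP; apply: measurable_funM => //.
  by apply: measurable_funX; exact: measurable_norm (mf 0%N).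
have mE : measurable_fun setT (fun x => (8 * N%:R * Err x)%:E).
  by apply/measurable_EFinP; apply: measurable_funM => //; exact: measurable_cst.
apply: (@le_trans _ _ (\int[P]_x ((8 * lqnorm q G N (H x) ^+ 2)%:E +
   ((8 * `|f 0%N x| ^+ 2)%:E + (8 * N%:R * Err x)%:E)))%E).
  apply: ge0_le_integral => //.
  - by move=> x _; rewrite lee_fin sqr_ge0.
  - apply/measurable_EFinP; apply: measurable_funX.
    by apply: measurable_minr => //; exact: measurable_cst.
  - by apply: emeasurable_funD => //; exact: emeasurable_funD.
  - by move=> x _; rewrite -!EFinD lee_fin.
have ge0G x : (0 <= (8 * lqnorm q G N (H x) ^+ 2)%:E)%E.
  by rewrite lee_fin mulr_ge0 // sqr_ge0.
have ge0f x : (0 <= (8 * `|f 0%N x| ^+ 2)%:E)%E.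
  by rewrite lee_fin mulr_ge0 // sqr_ge0.
have ge0E x : (0 <= (8 * N%:R * Err x)%:E)%E by rewrite lee_fin !mulr_ge0.
rewrite ge0_integralD //; last 2 first.
- by move=> x _; exact: adde_ge0.
- exact: emeasurable_funD.
rewrite ge0_integralD //.
have -> : ((1040 * C0 + 8) * M ^+ 2)%:E + e%:E =
    (1040 * C0 * M ^+ 2)%:E + ((8 * M ^+ 2)%:E + e%:E) :> \bar R.
  by rewrite -!EFinD mulrDl addrA.
apply: leeD; last apply: leeD.
- rewrite (expectation_fin P mH (g := fun i => 8 * lqnorm q G N i ^+ 2)); last first.
    by move=> i; rewrite mulr_ge0 // sqr_ge0.
  rewrite lee_fin; apply: le_trans bG; rewrite mulr_sumr.
  by apply: ler_sum => i _; rewrite mulrCA.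
- under eq_integral do rewrite EFinM.
  have mf0' : measurable_fun setT (fun x => (`|f 0%N x| ^+ 2)%:E).
    by apply/measurable_EFinP; apply: measurable_funX; exact: measurable_norm (mf 0%N).
  have f00 x : setT x -> (0 <= (`|f 0%N x| ^+ 2)%:E)%E by rewrite lee_fin sqr_ge0.
  rewrite ge0_integralZl_EFin //.
  by rewrite [leRHS]EFinM; apply: lee_wpmul2l => //; exact: fM.
- under eq_integral do rewrite EFinM.
  have mErr' : measurable_fun setT (fun x => (Err x)%:E) by exact/measurable_EFinP.
  have Err0' x : setT x -> (0 <= (Err x)%:E)%E by rewrite lee_fin.
  have c0 : 0 <= 8 * N%:R :> R by rewrite mulr_ge0.
  rewrite ge0_integralZl_EFin //.
  rewrite /Err (integral_sum_norm P (u := fun j x => `|f j x - g j (H x)|)) //; last first.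
    by move=> j; exact: measurable_norm_sub (mf j) (mgH j).
  apply: (@le_trans _ _ ((8 * N%:R)%:E * \sum_(j < N.+1) eta%:E)%E).
    apply: lee_wpmul2l; first by rewrite lee_fin mulr_ge0.
    by apply: lee_sum => j _; apply: gclose; rewrite -ltnS.
  rewrite sumEFin sumr_const card_ord -EFinM lee_fin -[eta *+ _]mulr_natr.
  have -> : 8 * N%:R * (eta * N.+1%:R) = e * (N%:R / N.+1%:R).
    by rewrite /eta; field; rewrite !gt_eqF.
  rewrite ger_pMr // ler_pdivrMr // mul1r ler_nat //.
Qed.

Lemma Sq_L2_bound F (f : nat -> T -> B) (M : R) :
  filtration F -> martingale P F f ->
  (forall n, (\int[P]_x (`|f n x| ^+ 2)%:E <= (M ^+ 2)%:E)%E) ->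
  (\int[P]_x (`|Sq q f x| `^ 2) <= ((1040 * C0 + 8) * M ^+ 2)%:E)%E.
Proof.
move=> Ff Mf fM; have [_ [Fm _]] := Ff; have [Ms _] := Mf.
have mf n : strongly_measurable measurable (f n).
  exact: strongly_measurable_sub (Fm n) (Ms n).
pose h N x := (Num.min (pSq q f N.+1 x) N%:R ^+ 2)%:E.
have min0 N x : 0 <= Num.min (pSq q f N.+1 x) N%:R by rewrite le_min pSq_ge0 ler0n.
have h0 N x : setT x -> (0 <= h N x)%E by rewrite lee_fin sqr_ge0.
have mh N : measurable_fun setT (h N).
  apply/measurable_EFinP; apply: measurable_funX.
  by apply: measurable_minr; [exact: measurable_pSq|exact: measurable_cst].
have ndh x : setT x -> nondecreasing_seq (h ^~ x).
  move=> _ n m nm; rewrite lee_fin ler_sqr ?nnegrE //.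
  rewrite le_min !ge_min ler_nat nm orbT andbT; apply/orP; left.
  exact: pSq_le.
have MC := monotone_convergence P measurableT mh h0 ndh.
apply: (@le_trans _ _ (\int[P]_x limn (h ^~ x))%E); last first.
  rewrite MC; apply: lime_le.
    apply: ereal_nondecreasing_is_cvgn => n m nm.
    by apply: ge0_le_integral => // x Tx; [exact: h0|exact: ndh].
  by apply: nearW => N; exact: truncated_L2_bound Ff Mf fM.
have hl x N : (h N x <= limn (h ^~ x))%E.
  have := ereal_nondecreasing_cvgn (ndh x I).
  move=> /cvg_lim -> //; apply: ereal_sup_ubound; by exists N.
apply: ge0_le_integral => //.
- by move=> x _; exact: poweR_ge0.
- apply: (measurableT_comp (measurable_poweR 2)).
  by apply: measurableT_comp => //; exact: measurable_Sq.
- apply: (emeasurable_fun_cvg h) => // x _.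
  by apply: ereal_nondecreasing_is_cvgn; exact: ndh.
move=> x _; have := hl x; case: (limn (h ^~ x)) => [r| |] hx; last 2 first.
- exact: leey.
- by have := hx 0%N; rewrite leeNy_eq.
have r0 : 0 <= r by rewrite -lee_fin; exact: le_trans (h0 0%N x I) (hx 0%N).
have Sy : (Sq q f x <= (Num.sqrt r)%:E)%E.
  apply: (Sq_le q0 (sqrtr_ge0 r)) => N.
  pose K := maxn N (Num.truncn (Num.sqrt r)).+1.
  have Kr : Num.sqrt r < K%:R.
    apply: lt_le_trans (truncnS_gt _) _; rewrite ler_nat; exact: leq_maxr.
  have : Num.min (pSq q f K.+1 x) K%:R <= Num.sqrt r.
    by rewrite -[leLHS]ger0_norm // -sqrtr_sqr ler_sqrt // -lee_fin; exact: hx.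
  rewrite ge_min leNgt => /orP[|]; last by rewrite leNgt Kr.
  rewrite -leNgt; apply: le_trans; apply: pSq_le => //.
  by rewrite leqW // leq_maxl.
rewrite gee0_abs ?poweR_ge0 //.
have -> : r%:E = poweR (Num.sqrt r)%:E 2.
  by rewrite poweR_EFin powR_mulrn ?sqrtr_ge0 // sqr_sqrtr.
apply: gt0_ler_poweR => //.
- by rewrite in_itv /= leey andbT; exact: poweR_ge0.
- by rewrite in_itv /= leey andbT lee_fin sqrtr_ge0.
Qed.

End TightImpliesCotype.

Lemma tight_cotype {R : realType} (B : completeNormedModType R) (q : R) :
  2 <= q -> tight B q -> martingale_cotype B q.
Proof.
move=> q2 Ht; have [C0 C00 HC0] := tight_L2 q2 Ht.
pose K := 1040 * C0 + 8.
have K0 : 0 < K by rewrite /K; lra.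
exists 2; split; first by lra.
exists (Num.sqrt K) => d T P F f Ff Mf.
set s := ereal_sup _.
have fs n : (LpB P 2 (f n) <= s)%E by apply: ereal_sup_ubound; exists n.
have s0 : (0 <= s)%E by apply: le_trans (fs 0%N); exact: Lnorm_ge0.
case: s fs s0 => [M| |] fs s0; last 2 first.
- by rewrite gt0_muley ?leey // lte_fin sqrtr_gt0.
- by [].
rewrite lee_fin in s0.
have fM n := LpB2_le s0 (fs n).
have I := Sq_L2_bound q2 C00 (@HC0) Ff Mf fM.
rewrite -EFinM unlock.
have -> : (Num.sqrt K * M)%:E = poweR (K * M ^+ 2)%:E 2^-1.
  rewrite poweR_EFin powR12_sqrt; last by rewrite mulr_ge0 ?sqr_ge0 // ltW.
  by rewrite sqrtrM ?(ltW K0) // sqrtr_sqr ger0_norm.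
apply: gt0_ler_poweR => //.
- by rewrite in_itv /= leey andbT; apply: integral_ge0 => x _; exact: poweR_ge0.
- by rewrite in_itv /= leey andbT lee_fin mulr_ge0 ?sqr_ge0 // ltW.
Qed.

Theorem theorem7p4 (R : realType) (B : completeNormedModType R) (q : R)
  (hq2 : 2 <= q) :
  martingale_cotype B q <->
  (forall (d : measure_display) (T : measurableType d)
          (P : probability T R) (F : nat -> set (set T))
          (f : nat -> T -> B),
     filtration F -> martingale P F f ->
     (ereal_sup (range (fun n => LpB P 1 (f n))) < +oo)%E ->
     {ae P, forall x, (Sq q f x < +oo)%E}).
Proof.
split=> [Hc d T P F f Ff Mf Hs|Hae].
  apply: tight_convergence Ff Mf Hs; first by lra.
  exact: cotype_tight.
apply: tight_cotype => //; apply: convergence_tight => //.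
by lra.
Qed.
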